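(* Let $G$ be the one-paired circulant graph $G=C(n;a,b)$. Then $G$ is $S_2$ if and only if $n=ab$, i.e., $G$ is Cohen-Macaulay.
   Context: For an integer $n\geq 1$ and $S\subseteq\{1,2,\ldots,\lfloor n/2\rfloor\}$, the circulant graph $C_n(S)$ has vertex set $\{0,1,\ldots,n-1\}$ and edge set $\{\{i,j\} : |i-j|\in S \text{ or } n-|i-j|\in S\}$. For a pair $(a,b)$ of positive integers with $ab\mid n$, the one-paired circulant graph $C(n;a,b)$ is $C_n(S)$ with $S=\{d\in\{1,\ldots,\lfloor n/2\rfloor\} : a\mid d \text{ and } ab\nmid d\}$. The independence complex $\mathrm{Ind}(G)$ of a finite simple graph $G$ is the simplicial complex whose faces are the independent sets of $G$ (including the empty set). A simplicial complex is Cohen-Macaulay if its Stanley-Reisner ring over every field is Cohen-Macaulay; $G$ is Cohen-Macaulay if $\mathrm{Ind}(G)$ is. A simplicial complex $\Delta$ satisfies Serre's condition $S_2$ (over a field $k$) if its Stanley-Reisner ring $R=k[\Delta]$ satisfies $\mathrm{depth}(R_p)\geq\min\{2,\dim R_p\}$ for all primes $p$. It is known that this holds if and only if $\mathrm{link}_\Delta(F)$ is connected for every face $F\in\Delta$ (including $F=\emptyset$) with $\dim\mathrm{link}_\Delta(F)\geq 1$, where $\mathrm{link}_\Delta(F)=\{H\in\Delta : H\cap F=\emptyset,\ H\cup F\in\Delta\}$; in particular it does not depend on $k$. A graph $G$ is called $S_2$ if $\mathrm{Ind}(G)$ satisfies $S_2$.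
   Formalization: The case b = 1 is excluded: there S is empty, so G has no edges and is Cohen-Macaulay and S_2 for every n, and the claim fails whenever n ≠ a (e.g. n = 2, a = b = 1); the trivial true case b = 1, n = a is dropped with it. *)

(* Defs.v *)
From HB Require Import structures.
From mathcomp Require Import all_boot all_order all_algebra.
From mathcomp Require Import ring_quotient boolp.
From mathcomp Require Import ring mpoly.

Set Implicit Arguments.
Unset Strict Implicit.
Unset Printing Implicit Defensive.

Import GRing.Theory.

Local Open Scope ring_scope.
Local Open Scope quotient_scope.

(* Localization of a commutative ring at a prime ideal: fractions r / s with
   s outside p, where r / s = r' / s' iff u * (r * s' - r' * s) = 0 for some u
   outside p. The ring may have zero divisors, so {fraction R} does not apply. *)

Section Localization.
Variables (R : comNzRingType) (p : prime_idealr R).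

Record pfrac := PFrac { pfrac_val :> R * R; _ : pfrac_val.2 \notin p }.

HB.instance Definition _ := [isSub for pfrac_val].
HB.instance Definition _ := [Choice of pfrac by <:].

Lemma pfrac_den (x : pfrac) : x.2 \notin p. Proof. by case: x. Qed.

Lemma notin_prime1 : 1 \notin p. Proof. by rewrite idealr1. Qed.

Lemma notin_primeM s t : s \notin p -> t \notin p -> s * t \notin p.
Proof. by move=> sp tp; rewrite prime_idealrM negb_or sp. Qed.

Definition equivp (x y : pfrac) : bool :=
  `[< exists2 u : R, u \notin p & u * (x.1 * y.2 - y.1 * x.2) = 0 >].

Lemma equivp_refl : reflexive equivp.
Proof.
by move=> x; apply/asboolP; exists 1; rewrite ?notin_prime1 // subrr mulr0.
Qed.

Lemma equivp_sym : ssrbool.symmetric equivp.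
Proof.
suff sym x y : equivp x y -> equivp y x by move=> x y; apply/idP/idP; apply: sym.
move=> /asboolP[u up uxy]; apply/asboolP; exists u => //.
by rewrite -opprB mulrN uxy oppr0.
Qed.

Lemma equivp_trans : transitive equivp.
Proof.
move=> y x z /asboolP[u up uxy] /asboolP[v vp vyz]; apply/asboolP.
exists (u * v * y.2); first by rewrite !notin_primeM ?pfrac_den.
have -> : u * v * y.2 * (x.1 * z.2 - z.1 * x.2) =
  v * z.2 * (u * (x.1 * y.2 - y.1 * x.2)) +
  u * x.2 * (v * (y.1 * z.2 - z.1 * y.2)) by ring.
by rewrite uxy vyz !mulr0 addr0.
Qed.

Canonical equivp_equiv := EquivRel equivp equivp_refl equivp_sym equivp_trans.

Definition localization := {eq_quot equivp}.

HB.instance Definition _ : EqQuotient _ equivp localization :=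
  EqQuotient.on localization.
HB.instance Definition _ := Choice.on localization.

Lemma pi_pfracP (x y : pfrac) :
  \pi_localization x = \pi_localization y <->
  exists2 u : R, u \notin p & u * (x.1 * y.2 - y.1 * x.2) = 0.
Proof. by split=> [/eqmodP/asboolP//|h]; apply/eqmodP/asboolP. Qed.

Definition pfrac_of (r : R) : pfrac := @PFrac (r, 1) notin_prime1.
Definition addp (x y : pfrac) : pfrac :=
  @PFrac (x.1 * y.2 + y.1 * x.2, x.2 * y.2)
         (notin_primeM (pfrac_den x) (pfrac_den y)).
Definition oppp (x : pfrac) : pfrac := @PFrac (- x.1, x.2) (pfrac_den x).
Definition mulp (x y : pfrac) : pfrac :=
  @PFrac (x.1 * y.1, x.2 * y.2) (notin_primeM (pfrac_den x) (pfrac_den y)).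

Definition to_localization (r : R) : localization :=
  \pi_localization (pfrac_of r).
Definition add_localization (x y : localization) : localization :=
  \pi_localization (addp (repr x) (repr y)).
Definition opp_localization (x : localization) : localization :=
  \pi_localization (oppp (repr x)).
Definition mul_localization (x y : localization) : localization :=
  \pi_localization (mulp (repr x) (repr y)).

Lemma repr_pfracP (x : pfrac) : exists2 u : R, u \notin p &
  u * ((repr (\pi_localization x)).1 * x.2 -
       x.1 * (repr (\pi_localization x)).2) = 0.
Proof. by apply/pi_pfracP; rewrite reprK. Qed.

Lemma pi_addp (x y : pfrac) : \pi_localization (addp x y) =
  add_localization (\pi_localization x) (\pi_localization y).
Proof.
apply/esym/pi_pfracP; have [u up hu] := repr_pfracP x.
have [v vp hv] := repr_pfracP y; exists (u * v); first exact: notin_primeM.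
move: (repr (\pi x)) (repr (\pi y)) hu hv => x' y' hu hv /=.
have -> : u * v * ((x'.1 * y'.2 + y'.1 * x'.2) * (x.2 * y.2) -
    (x.1 * y.2 + y.1 * x.2) * (x'.2 * y'.2)) =
  v * y'.2 * y.2 * (u * (x'.1 * x.2 - x.1 * x'.2)) +
  u * x'.2 * x.2 * (v * (y'.1 * y.2 - y.1 * y'.2)) by ring.
by rewrite hu hv !mulr0 addr0.
Qed.

Lemma pi_oppp (x : pfrac) : \pi_localization (oppp x) =
  opp_localization (\pi_localization x).
Proof.
apply/esym/pi_pfracP; have [u up hu] := repr_pfracP x; exists u => //.
move: (repr _) hu => x' hu /=.
have -> : u * (- x'.1 * x.2 - - x.1 * x'.2) =
  - (u * (x'.1 * x.2 - x.1 * x'.2)) by ring.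
by rewrite hu oppr0.
Qed.

Lemma pi_mulp (x y : pfrac) : \pi_localization (mulp x y) =
  mul_localization (\pi_localization x) (\pi_localization y).
Proof.
apply/esym/pi_pfracP; have [u up hu] := repr_pfracP x.
have [v vp hv] := repr_pfracP y; exists (u * v); first exact: notin_primeM.
move: (repr (\pi x)) (repr (\pi y)) hu hv => x' y' hu hv /=.
have -> : u * v * (x'.1 * y'.1 * (x.2 * y.2) - x.1 * y.1 * (x'.2 * y'.2)) =
  v * y'.1 * y.2 * (u * (x'.1 * x.2 - x.1 * x'.2)) +
  u * x.1 * x'.2 * (v * (y'.1 * y.2 - y.1 * y'.2)) by ring.
by rewrite hu hv !mulr0 addr0.
Qed.

Lemma eq_pi_pfrac (x y : pfrac) :
  x.1 * y.2 = y.1 * x.2 -> \pi_localization x = \pi_localization y.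
Proof.
move=> xy; apply/pi_pfracP; exists 1; first exact: notin_prime1.
by rewrite xy subrr mulr0.
Qed.

Fact add_localizationA : associative add_localization.
Proof.
elim/quotW=> x; elim/quotW=> y; elim/quotW=> z.
rewrite -(pi_addp y z) -(pi_addp x) -(pi_addp x y) -(pi_addp _ z).
by apply: eq_pi_pfrac => /=; ring.
Qed.

Fact add_localizationC : commutative add_localization.
Proof.
elim/quotW=> x; elim/quotW=> y; rewrite -(pi_addp x) -(pi_addp y).
by apply: eq_pi_pfrac => /=; ring.
Qed.

Fact add_localization0 : left_id (to_localization 0) add_localization.
Proof.
elim/quotW=> x; rewrite /to_localization -pi_addp.
by apply: eq_pi_pfrac => /=; ring.
Qed.

Fact add_localizationN :
  left_inverse (to_localization 0) opp_localization add_localization.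
Proof.
elim/quotW=> x; rewrite /to_localization -pi_oppp -pi_addp.
by apply: eq_pi_pfrac => /=; ring.
Qed.

HB.instance Definition _ := GRing.isZmodule.Build localization
  add_localizationA add_localizationC add_localization0 add_localizationN.

Fact mul_localizationA : associative mul_localization.
Proof.
elim/quotW=> x; elim/quotW=> y; elim/quotW=> z.
rewrite -(pi_mulp y z) -(pi_mulp x) -(pi_mulp x y) -(pi_mulp _ z).
by apply: eq_pi_pfrac => /=; ring.
Qed.

Fact mul_localizationC : commutative mul_localization.
Proof.
elim/quotW=> x; elim/quotW=> y; rewrite -(pi_mulp x) -(pi_mulp y).
by apply: eq_pi_pfrac => /=; ring.
Qed.

Fact mul_localization1 : left_id (to_localization 1) mul_localization.
Proof.
elim/quotW=> x; rewrite /to_localization -pi_mulp.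
by apply: eq_pi_pfrac => /=; ring.
Qed.

Fact mul_localizationDl : left_distributive mul_localization add_localization.
Proof.
elim/quotW=> x; elim/quotW=> y; elim/quotW=> z.
rewrite -(pi_addp x) -(pi_mulp _ z) -(pi_mulp x) -(pi_mulp y) -pi_addp.
by apply: eq_pi_pfrac => /=; ring.
Qed.

Fact localization1_neq0 : to_localization 1 != to_localization 0.
Proof.
apply/eqP=> /pi_pfracP[u up] /=; rewrite !mulr1 subr0 mulr1 => u0.
by move: up; rewrite u0 idealr0.
Qed.

HB.instance Definition _ := GRing.Zmodule_isComNzRing.Build localization
  mul_localizationA mul_localizationC mul_localization1 mul_localizationDl
  localization1_neq0.

End Localization.

Section CommutativeAlgebra.

Definition span_ideal (R : comNzRingType) (s : seq R) (x : R) : Prop :=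
  exists c : 'I_(size s) -> R, x = \sum_i c i * s`_i.

Definition invertible (R : comNzRingType) (x : R) : Prop :=
  exists y, y * x = 1.

Definition regular_seq (R : comNzRingType) (s : seq R) : Prop :=
  ~ span_ideal s 1 /\
  forall i x, (i < size s)%N ->
    span_ideal (take i s) (s`_i * x) -> span_ideal (take i s) x.

Definition prime_chain (R : comNzRingType) (d : nat)
    (P : 'I_d.+1 -> prime_idealr R) : Prop :=
  forall i j : 'I_d.+1, (i < j)%N ->
    {subset P i <= P j} /\ exists2 x, x \in P j & x \notin P i.

Definition is_maximum (A : nat -> Prop) (d : nat) : Prop :=
  A d /\ forall e, A e -> (e <= d)%N.

Definition krull_dim (R : comNzRingType) : nat -> Prop :=
  is_maximum (fun d => exists P : 'I_d.+1 -> prime_idealr R, prime_chain P).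

(* The maximal ideal of a local ring consists of its non-invertible elements. *)
Definition local_depth (L : comNzRingType) : nat -> Prop :=
  is_maximum (fun d => exists s : seq L,
    [/\ size s = d, forall x, x \in s -> ~ invertible x & regular_seq s]).

(* These are conditions on Noetherian rings: the local rings then have finite
   depth and dimension, so asking for the two values to exist is no
   restriction. *)
Definition serre (r : nat) (R : comNzRingType) : Prop :=
  forall p : prime_idealr R, exists t d : nat,
    [/\ local_depth (localization p) t, krull_dim (localization p) d
      & (minn r d <= t)%N].

Definition cohen_macaulay (R : comNzRingType) : Prop :=
  forall p : prime_idealr R, exists d : nat,
    local_depth (localization p) d /\ krull_dim (localization p) d.

End CommutativeAlgebra.

Record complex (V : finType) := Complex {
  faces :> {set {set V}};
  faces0 : set0 \in faces;
  facesS : forall A B : {set V}, A \subset B -> B \in faces -> A \in faces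
}.

Section StanleyReisner.
Variables (k : fieldType) (n : nat) (D : complex 'I_n).

Definition face_monomial (F : {set 'I_n}) : {mpoly k[n]} := \prod_(i in F) 'X_i.

Definition sr_ideal : {pred {mpoly k[n]}} := fun f =>
  `[< exists c : {set 'I_n} -> {mpoly k[n]},
        f = \sum_(F : {set 'I_n} | F \notin faces D) c F * face_monomial F >].

Fact sr_ideal_closed : idealr_closed sr_ideal.
Proof.
split.
- by apply/asboolP; exists (fun=> 0); rewrite big1 // => F _; rewrite mul0r.
- apply/negP=> /asboolP[c /(congr1 (meval (fun=> 0 : k)))].
  rewrite meval1 raddf_sum big1 => [/eqP|F FD]; first by rewrite oner_eq0.
  have [F0|[i iF]] := set_0Vmem F; first by rewrite F0 faces0 in FD.
  by rewrite /= mevalM /face_monomial (bigD1 i) //= mevalM mevalXU mul0r mulr0.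
- move=> a f g /asboolP[c ->] /asboolP[d ->]; apply/asboolP.
  exists (fun F => a * c F + d F).
  rewrite mulr_sumr -big_split /=; apply: eq_bigr => F _.
  by rewrite mulrDl mulrA.
Qed.

HB.instance Definition _ := isIdealr.Build {mpoly k[n]} sr_ideal sr_ideal_closed.

Definition sr_ring : comNzRingType := {ideal_quot sr_ideal}.

End StanleyReisner.

Definition complex_serre (k : fieldType) n (r : nat) (D : complex 'I_n) : Prop :=
  serre r (sr_ring k D).

Definition complex_cohen_macaulay n (D : complex 'I_n) : Prop :=
  forall k : fieldType, cohen_macaulay (sr_ring k D).

Record sgraph (V : finType) := SGraph {
  adj :> rel V;
  adj_sym : ssrbool.symmetric adj;
  adj_irr : irreflexive adj
}.

Section IndependenceComplex.
Variables (V : finType) (G : sgraph V).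

Definition independent_sets : {set {set V}} :=
  [set A : {set V} | [forall x in A, forall y in A, ~~ G x y]].

Fact independent_sets0 : set0 \in independent_sets.
Proof. by rewrite inE; apply/forall_inP=> x; rewrite inE. Qed.

Fact independent_setsS (A B : {set V}) :
  A \subset B -> B \in independent_sets -> A \in independent_sets.
Proof.
rewrite !inE => /subsetP AB /forall_inP hB; apply/forall_inP=> x xA.
by apply/forall_inP=> y yA; apply: (forall_inP (hB x (AB x xA))); apply: AB.
Qed.

Definition Ind : complex V := Complex independent_sets0 independent_setsS.

End IndependenceComplex.

Definition serre_graph (k : fieldType) (r n : nat) (G : sgraph 'I_n) : Prop :=
  complex_serre k r (Ind G).

Definition cohen_macaulay_graph n (G : sgraph 'I_n) : Prop :=
  complex_cohen_macaulay (Ind G).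

Definition connection_set (n : nat) (S : {pred nat}) : Prop :=
  forall d, d \in S -> (1 <= d <= n./2)%N.

Section Circulant.
Variables (n : nat) (S : {pred nat}) (S_ok : connection_set n S).

Definition circulant_rel : rel 'I_n := fun i j =>
  (`|i%:Z - j%:Z|%N \in S) || ((n - `|i%:Z - j%:Z|)%N \in S).

Fact circulant_sym : ssrbool.symmetric circulant_rel.
Proof. by move=> i j; rewrite /circulant_rel distnC. Qed.

Fact circulant_irr : irreflexive circulant_rel.
Proof.
move=> i; rewrite /circulant_rel distnn subn0; apply/norP; split; apply/negP.
  by move=> /S_ok.
move=> /S_ok/andP[n_gt0]; rewrite leqNgt; case: (n) n_gt0 => // m _.
by rewrite ltn_half_double -addnn -addSnnS leq_addr.
Qed.

Definition circulant : sgraph 'I_n := SGraph circulant_sym circulant_irr.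

End Circulant.

Definition one_paired_set (n a b : nat) : {pred nat} := fun d =>
  [&& (1 <= d <= n./2)%N, (a %| d)%N & ~~ (a * b %| d)%N].

Fact one_paired_setP n a b : connection_set n (one_paired_set n a b).
Proof. by move=> d /and3P[]. Qed.

Definition one_paired (n a b : nat) : sgraph 'I_n :=
  circulant (@one_paired_setP n a b).

(* Main.v *)
Require Import Defs.
From HB Require Import structures.
From mathcomp Require Import all_boot all_order all_algebra.
From mathcomp Require Import ring_quotient boolp ring zify mpoly.
From mathcomp Require classical_sets.

(* Write n = a b m. The graph is a disjoint union of a complete multipartite
   graphs, each with b parts of size m, so its independence complex is the join
   of a copies of a disjoint union of b simplices on m vertices.

   If m > 1, the link of the face F formed by one part in each of the copies
   other than the first is a disjoint union of simplices of positive dimension.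
   At the prime generated by the variables outside F, the local ring has
   dimension at least 2, but its maximal ideal is a sum I1 + I2 of nonzero
   ideals with I1 I2 = 0, which bounds the depth by 1.

   If m = 1, the Stanley-Reisner ring R is the tensor product of a copies of
   k[x_1, ..., x_b] / (x_i x_j, i <> j). Let theta_j be the sum of the variables
   of the j-th copy, and for a prime p of R let T be a maximal set of indices
   such that the theta_j, j in T, are algebraically independent modulo p. Every
   theta_j with j outside T satisfies modulo p a nonzero relation g_j over
   k[theta_T]; these a - |T| elements of p form a regular sequence in R_p. On
   the other hand every prime contains all but one variable of each copy, so
   k[theta] maps onto R / Q for each prime Q, and the algebraic independence
   modulo Q of a subset of the theta_j strictly improves along a chain of primes
   going down from p; hence chains have length at most a - |T|. Since a regular
   sequence yields a prime chain of the same length, depth and dimension of R_p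
   are both equal to a - |T|. *)

Set Implicit Arguments.
Unset Strict Implicit.
Unset Printing Implicit Defensive.

Import GRing.Theory.
Local Open Scope ring_scope.
Local Open Scope quotient_scope.

(** * Primes, regular sequences and depth *)

Section Ideals.
Variable R : comNzRingType.

Definition is_prime (P : R -> Prop) : Prop :=
  [/\ P 0, ~ P 1, forall a u v, P u -> P v -> P (a * u + v)
    & forall u v, P (u * v) -> P u \/ P v].

(** Classical decidability turns a [Prop]-valued prime into a boolean one, so primes can be given by
    existential descriptions. *)
Lemma prime_idealrP (P : R -> Prop) : is_prime P ->
  exists Q : prime_idealr R, forall x, x \in Q <-> P x.
Proof.
move=> [P0 P1 PD PM].
pose S : {pred R} := fun x => `[< P x >].
have SP x : (x \in S) <-> P x by split=> /asboolP.
have Sid : idealr_closed S.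
  split; first exact/SP; first by apply/negP=> /SP.
  by move=> a u v /SP Pu /SP Pv; apply/SP/PD.
have Spr : prime_idealr_closed S.
  by move=> u v /SP/PM[]/SP->; rewrite ?orbT.
pose c1 := isIdealr.Build R S Sid.
pose c2 := isPrimeIdealrClosed.Build R S Spr.
by exists (HB.pack_for (prime_idealr R) S c1 c2).
Qed.

Lemma span0 (s : seq R) : span_ideal s 0.
Proof. by exists (fun=> 0); rewrite big1 // => i _; rewrite mul0r. Qed.

Lemma spanD (s : seq R) a u v :
  span_ideal s u -> span_ideal s v -> span_ideal s (a * u + v).
Proof.
move=> [c ->] [d ->]; exists (fun i => a * c i + d i).
rewrite mulr_sumr -big_split /=; apply: eq_bigr => i _.
by rewrite mulrDl mulrA.
Qed.

Lemma spanM (s : seq R) a u : span_ideal s u -> span_ideal s (a * u).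
Proof. by move=> su; rewrite -[_ * _]addr0; apply: spanD => //; apply: span0. Qed.

Lemma span_add (s : seq R) u v :
  span_ideal s u -> span_ideal s v -> span_ideal s (u + v).
Proof. by move=> su sv; rewrite -[u]mul1r; apply: spanD. Qed.

Lemma span_nth (s : seq R) i : (i < size s)%N -> span_ideal s s`_i.
Proof.
move=> si; exists (fun j => (j == Ordinal si)%:R).
rewrite (bigD1 (Ordinal si)) //= eqxx mul1r big1 ?addr0 // => j /negPf->.
by rewrite mul0r.
Qed.

Lemma span_sub (s : seq R) (P : R -> Prop) :
  P 0 -> (forall a u v, P u -> P v -> P (a * u + v)) ->
  (forall x, x \in s -> P x) -> forall x, span_ideal s x -> P x.
Proof.
move=> P0 PD Ps x [c ->]; elim/big_ind: _ => // [u v Pu Pv|i _].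
  by rewrite -[u]mul1r; apply: PD.
by rewrite -[_ * _]addr0; apply: PD => //; apply: Ps; rewrite mem_nth.
Qed.

(** Zorn's lemma: an ideal maximal among those containing [I] and disjoint from the multiplicative
    set [M] is prime. *)
Lemma prime_avoiding (I M : R -> Prop) :
  I 0 -> (forall a u v, I u -> I v -> I (a * u + v)) ->
  M 1 -> (forall x y, M x -> M y -> M (x * y)) ->
  (forall x, M x -> ~ I x) ->
  exists Q : prime_idealr R,
    (forall x, I x -> x \in Q) /\ (forall x, M x -> x \notin Q).
Proof.
move=> I0 ID M1 MM MI.
pose good (A : R -> Prop) := [/\ forall x, I x -> A x,
  forall a u v, A u -> A v -> A (a * u + v) & forall x, M x -> ~ A x].
pose P : classical_sets.set (classical_sets.set R) :=
  fun A => (forall x, ~ A x) \/ good A.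
have [F FP Ftot|A [PA Amax]] := @classical_sets.Zorn_bigcup R P.
  have [[B FB gB]|nF] := pselect (exists2 B, F B & good B); last first.
    left=> x [B FB Bx]; have [/(_ x)//|gB] := FP B FB.
    by apply: nF; exists B.
  right; split.
  - by move=> x Ix; exists B => //; case: gB => h _ _; apply: h.
  - move=> a u v [B1 F1 u1] [B2 F2 v2].
    have gd C x : F C -> C x -> good C by move=> FC Cx; case: (FP C FC) => [/(_ x)|].
    case: (Ftot B1 B2 F1 F2) => h.
      by exists B2 => //; case: (gd _ _ F2 v2) => _ hD _; apply: hD => //; apply: h.
    by exists B1 => //; case: (gd _ _ F1 u1) => _ hD _; apply: hD => //; apply: h.
  - move=> x Mx [C FC Cx]; case: (FP C FC) => [/(_ x)//|[_ _ h]].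
    exact: (h x).
have gA : good A.
  case: PA => // A0; exfalso; apply: (Amax I); last by right; split.
  by split=> [x /A0//|/(_ 0 I0)/A0].
have [AI AD AM] := gA.
have A0 : A 0 by apply: AI.
have [|Q QA] := @prime_idealrP A; last first.
  by exists Q; split=> x => [/AI/QA//|/AM h]; apply/negP=> /QA.
split=> //; first exact: AM.
(* By maximality, the larger ideal [A + (u)] meets [M]. *)
have ext u : ~ A u -> exists2 m, M m & exists r, A (m - r * u).
  move=> nAu; apply: contrapT => nex.
  pose B x := exists r, A (x - r * u).
  apply: (Amax B); last first.
    right; split.
    - by move=> x Ix; exists 0; rewrite mul0r subr0; apply: AI.
    - move=> a x y [r rx] [t ty]; exists (a * r + t).
      have -> : a * x + y - (a * r + t) * u = a * (x - r * u) + (y - t * u) by ring.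
      exact: AD.
    - by move=> x Mx Bx; apply: nex; exists x.
  split; first by move=> x Ax; exists 0; rewrite mul0r subr0.
  by move=> /(_ u) h; apply: nAu; apply: h; exists 1; rewrite mul1r subrr.
move=> u v Auv; apply: contrapT => /not_orP[/ext[m Mm [r Ar]] /ext[l Ml [t At]]].
apply: (AM (m * l)); first exact: MM.
have -> : m * l = l * (m - r * u) + ((r * u) * (l - t * v) + ((r * t) * (u * v) + 0)).
  by ring.
by apply: (AD) => //; apply: (AD) => //; apply: (AD).
Qed.

Lemma prime_chain_steps (d : nat) (P : nat -> prime_idealr R) :
  (forall i, (i < d)%N -> {subset P i <= P i.+1} /\
     exists2 x, x \in P i.+1 & x \notin P i) ->
  @prime_chain R d (fun i => P i).
Proof.
move=> step i j; have := ltn_ord j; rewrite ltnS.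
elim: (j : nat) => // m IH md; rewrite ltnS leq_eqVlt => /orP[/eqP->|im].
  exact: step.
have [sub [x xm xi]] := IH (ltnW md) im.
have [sub' _] := step _ md.
by split; [move=> y /sub/sub'|exists x => //; apply: sub'].
Qed.

(** The chain is built downwards from a prime over the whole sequence, dropping one element of the
    sequence at each step. *)
Lemma regular_seq_chain (s : seq R) : regular_seq s ->
  exists P : 'I_(size s).+1 -> prime_idealr R, prime_chain P.
Proof.
move=> [s1 reg].
have chain i (Q : prime_idealr R) : (i <= size s)%N ->
    (forall x, span_ideal (take i s) x -> x \in Q) ->
    exists P : nat -> prime_idealr R, P i = Q /\
     (forall j, (j < i)%N -> {subset P j <= P j.+1} /\
     exists2 x, x \in P j.+1 & x \notin P j).
  elim: i Q => [|i IH] Q si sQ; first by exists (fun=> Q).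
  (* A prime avoiding [M] lies inside [Q] and misses the [i]-th element; regularity keeps [M]
     disjoint from the span of the earlier elements. *)
  pose M x := exists m t, t \notin Q /\ x = s`_i ^+ m * t.
  have memi : s`_i \in Q.
    have -> : s`_i = (take i.+1 s)`_i by rewrite nth_take.
    by apply/sQ/span_nth; rewrite size_take_min leq_min leqnn.
  have sub j x : span_ideal (take j s) x -> span_ideal (take j.+1 s) x.
    have [js|js] := leqP (size s) j; first by rewrite !take_oversize // ltnW.
    apply: span_sub => [|a u v|y]; [exact: span0|exact: spanD|].
    case/(nthP 0) => l; rewrite size_take_min leq_min => /andP[lj ls] <-.
    rewrite nth_take // -(@nth_take j.+1) ?(ltn_trans lj) //.
    by apply: span_nth; rewrite size_take_min leq_min ls (ltn_trans lj).
  have [||||x [m [t [tQ ->]]]|Q' [IQ' MQ']] := @prime_avoiding (span_ideal (take i s)) M.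
  - exact: span0.
  - by move=> a u v; apply: spanD.
  - by exists 0%N, 1; rewrite idealr1 expr0 mulr1.
  - move=> _ _ [m [t [tQ ->]]] [m' [t' [tQ' ->]]]; exists (m + m')%N, (t * t').
    by rewrite prime_idealrM negb_or tQ tQ' exprD; split=> //; ring.
  - elim: m => [|m IHm]; first by rewrite expr0 mul1r => /sub/sQ; apply/negP.
    by rewrite exprS -mulrA => /(reg i _ si)/IHm.
  have [P [Pi Pstep]] := IH Q' (ltnW si) IQ'.
  exists (fun j => if j == i.+1 then Q else P j); split; first by rewrite eqxx.
  move=> j; rewrite ltnS leq_eqVlt => /orP[/eqP->|ji].
    rewrite eqxx -[i == _]negbK neq_ltn ltnSn /= Pi; split.
      move=> x; apply: contraLR => xQ; apply: MQ'.
      by exists 0%N, x; rewrite expr0 mul1r.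
    exists s`_i => //; apply: MQ'; exists 1%N, 1.
    by rewrite idealr1 mulr1 expr1.
  have -> : (j == i.+1) = false by rewrite ltn_eqF // ltnW.
  by rewrite eqSS (ltn_eqF ji); apply: Pstep.
have [||||x ->|Q [sQ _]] := @prime_avoiding (span_ideal s) (fun x => x = 1).
- exact: span0.
- by move=> a u v; apply: spanD.
- by [].
- by move=> _ _ -> ->; rewrite mulr1.
- by [].
have [|x|P [_ Pstep]] := chain (size s) Q; first by [].
  by rewrite take_size; apply: sQ.
by exists (fun i => P i); apply: prime_chain_steps.
Qed.

(** Regular sequences yield prime chains of the same length, so a bound on chains also bounds the
    depth, and [s] attains both. *)
Lemma depth_eq_dim (d : nat) (s : seq R) :
  size s = d -> (forall x, x \in s -> ~ invertible x) -> regular_seq s ->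
  (forall e (P : 'I_e.+1 -> prime_idealr R), prime_chain P -> (e <= d)%N) ->
  local_depth R d /\ krull_dim R d.
Proof.
move=> <- sinv sreg chains; split; split.
- by exists s.
- move=> _ [t [<- _ treg]]; have [P Pchain] := regular_seq_chain treg.
  exact: chains Pchain.
- exact: regular_seq_chain.
- by move=> e [P]; apply: chains.
Qed.

(* If [s0 = u + v] and [s1 = u' + v'] with [u, u'] in [I1] and [v, v'] in [I2],
   then [s1 * u = u * u' = s0 * u'], so regularity gives [u = c * s0]; one of
   [c], [1 - c] being invertible, [u] or [v] is killed by [I1 + I2]. *)
Lemma depth_le1 (I1 I2 : R -> Prop) (y1 y2 : R) (s : seq R) :
  (forall c : R, invertible c \/ invertible (1 - c)) ->
  (forall x, ~ invertible x -> exists u v, [/\ I1 u, I2 v & x = u + v]) ->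
  (forall u v, I1 u -> I2 v -> u * v = 0) ->
  I1 y1 -> y1 <> 0 -> I2 y2 -> y2 <> 0 ->
  (forall x, x \in s -> ~ invertible x) -> regular_seq s -> (size s <= 1)%N.
Proof.
move=> loc dec I12 I1y y1n0 I2y y2n0 sinv [_ reg].
rewrite leqNgt; apply/negP=> s2.
have s0 : (0 < size s)%N by exact: ltn_trans s2.
have [u [v [Iu Iv e0]]] := dec _ (sinv _ (mem_nth 0 s0)).
have [u' [v' [Iu' Iv' e1]]] := dec _ (sinv _ (mem_nth 0 s2)).
have nzd x : s`_0 * x = 0 -> x = 0.
  move=> sx0; have := reg 0%N x s0; rewrite take0 sx0 => /(_ (span0 _))[c ->].
  by rewrite big_ord0.
have [c uc] : exists c, u = c * s`_0.
  have e : s`_1 * u = u' * s`_0.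
    rewrite e0 e1 mulrDl mulrDr [v' * u]mulrC (I12 u v') // (I12 u' v) //.
  have t1 : take 1 s = [:: s`_0] by case: (s) s0 => //= z l _; rewrite take0.
  have := reg 1%N u s2; rewrite t1 e => /(_ (spanM _ (@span_nth [:: s`_0] 0 isT))).
  by case=> c; rewrite big_ord1 => ->; exists (c ord0).
have rel : (1 - c) * u = c * v by rewrite mulrBl mul1r {1}uc e0; ring.
have [[w wc]|[w wc]] := loc c.
- have v0 : v = 0.
    apply: nzd; rewrite e0 mulrDl I12 // add0r.
    have {2}-> : v = w * (1 - c) * u by rewrite -mulrA rel mulrA wc mul1r.
    by rewrite mulrCA [v * u]mulrC (I12 u v) // mulr0.
  by apply: y2n0; apply: nzd; rewrite e0 v0 addr0 I12.
- have u0 : u = 0.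
    apply: nzd; rewrite e0 mulrDl [v * u]mulrC (I12 u v) // addr0.
    have {2}-> : u = w * c * v by rewrite -mulrA -rel mulrA wc mul1r.
    by rewrite mulrCA (I12 u v) // mulr0.
  by apply: y1n0; apply: nzd; rewrite e0 u0 add0r mulrC I12.
Qed.

End Ideals.

(** * Localization *)

Section LocalizationTheory.
Variables (R : comNzRingType) (p : prime_idealr R).
Local Notation L := (localization p).
Local Notation tl := (to_localization p).

Lemma to_localizationD : {morph tl : x y / x + y}.
Proof.
move=> x y; rewrite /to_localization; apply: etrans (pi_addp _ _).
by apply: eq_pi_pfrac => /=; ring.
Qed.

Lemma to_localizationM : {morph tl : x y / x * y}.
Proof.
move=> x y; rewrite /to_localization; apply: etrans (pi_mulp _ _).
by apply: eq_pi_pfrac => /=; ring.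
Qed.

Lemma to_localization_eq r r' :
  tl r = tl r' <-> exists2 u, u \notin p & u * (r - r') = 0.
Proof.
by split=> [/pi_pfracP|[u up e]]; [|apply/pi_pfracP; exists u => //];
  rewrite /= !mulr1.
Qed.

(** The fraction [r / s] is expressed by cross-multiplication, since [localization p] carries no
    inverse operation. *)
Lemma localizationP (x : L) : exists r s, s \notin p /\ x * tl s = tl r.
Proof.
elim/quotW: x => x; exists x.1, x.2; split; first exact: pfrac_den.
by rewrite /to_localization; apply: etrans (esym (pi_mulp _ _)) _;
  apply: eq_pi_pfrac => /=; ring.
Qed.

Lemma to_localization_unit s : s \notin p -> invertible (tl s).
Proof.
move=> sp; exists (\pi_L (@PFrac R p (1, s) sp)).
by rewrite /to_localization; apply: etrans (esym (pi_mulp _ _)) _;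
  apply: eq_pi_pfrac => /=; ring.
Qed.

Lemma to_localization_ninv r : r \in p -> ~ invertible (tl r).
Proof.
move=> rp [x]; have [q [s [sp xs]]] := localizationP x => xr.
have : tl s = tl (q * r) by rewrite to_localizationM -xs mulrAC xr mul1r.
move=> /to_localization_eq[u up] /eqP; rewrite mulrBr subr_eq0 => /eqP e.
have : u * s \in p by rewrite e mulrA idealMr.
by rewrite prime_idealrM (negPf up) (negPf sp).
Qed.

Lemma localization_ninv (x : L) r s :
  s \notin p -> x * tl s = tl r -> ~ invertible x -> r \in p.
Proof.
move=> sp xs; apply: contra_notT => /to_localization_unit[y yr].
by exists (y * tl s); rewrite -mulrA [tl s * _]mulrC xs.
Qed.

(** For [c = r / s], the numerators [r] and [s - r] cannot both lie in [p], since their sum [s] does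
    not. *)
Lemma localization_local (c : L) : invertible c \/ invertible (1 - c).
Proof.
have [r [s [sp cs]]] := localizationP c.
have [rp|/to_localization_unit[y yr]] := boolP (r \in p); last first.
  by left; exists (y * tl s); rewrite -mulrA [tl s * _]mulrC cs.
have : s - r \notin p by apply: contra sp => srp; rewrite -[s](subrK r) rpredD.
move=> /to_localization_unit[y yr]; right; exists (y * tl s).
rewrite -mulrA -[RHS]yr; congr (_ * _).
rewrite mulrBr mulr1 [_ * c]mulrC cs; apply/(addIr (tl r)).
by rewrite -to_localizationD !subrK.
Qed.

Lemma contract_prime (Q : prime_idealr L) : exists Q' : prime_idealr R,
  (forall r, (r \in Q') = (tl r \in Q)) /\ {subset Q' <= p}.
Proof.
have [|Q' QQ'] := @prime_idealrP R (fun r => tl r \in Q).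
  split.
  - exact: idealr0.
  - by apply/negP; rewrite idealr1.
  - by move=> a u v Qu Qv; rewrite to_localizationD to_localizationM rpredD ?idealMr.
  - by move=> u v; rewrite to_localizationM prime_idealrM => /orP.
exists Q'; split; first by move=> r; apply/idP/idP => /QQ'.
move=> r /QQ'; apply: contraTT => /to_localization_unit[y yr].
by apply/negP=> /(idealMr y); rewrite yr idealr1.
Qed.

Lemma contract_chain e (P : 'I_e.+1 -> prime_idealr L) : prime_chain P ->
  exists P' : 'I_e.+1 -> prime_idealr R,
    prime_chain P' /\ forall i, {subset P' i <= p}.
Proof.
move=> Pch; have /choice[P' P'P] := fun i => contract_prime (P i).
exists P'; split=> [i j /Pch[sub [x xj xi]]|i]; last by case: (P'P i).
have [[Ei _] [Ej _]] := (P'P i, P'P j).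
split; first by move=> r; rewrite Ei Ej => /sub.
have [r [s [sp xs]]] := localizationP x.
exists r; first by rewrite Ej -xs mulrC idealMr.
rewrite Ei -xs prime_idealrM negb_or xi.
have [y ys] := to_localization_unit sp.
by apply/negP=> /(idealMr y); rewrite ys idealr1.
Qed.

Lemma extend_prime (Q : prime_idealr R) : {subset Q <= p} ->
  exists Q' : prime_idealr L, forall r, (tl r \in Q') = (r \in Q).
Proof.
move=> Qp.
(* Whether the numerator lies in [Q] does not depend on the fraction chosen: denominators are
   outside [p], hence outside [Q]. *)
have key x r s r' s' : s \notin p -> x * tl s = tl r -> s' \notin p ->
    x * tl s' = tl r' -> r \in Q -> r' \in Q.
  move=> sp xs s'p xs' rQ.
  have : tl (s * r') = tl (s' * r).
    by rewrite !to_localizationM -xs -xs'; ring.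
  move=> /to_localization_eq[u up] /eqP; rewrite mulrBr subr_eq0 => /eqP e.
  have : u * (s * r') \in Q by rewrite e !idealMr.
  have nQ t : t \notin p -> (t \in Q) = false.
    by move=> tp; apply/negP=> /Qp; apply/negP.
  by rewrite !prime_idealrM (nQ u) ?(nQ s).
have [|Q' QQ'] := @prime_idealrP L
  (fun x => exists r s, [/\ s \notin p, x * tl s = tl r & r \in Q]).
  split.
  - by exists 0, 1; rewrite idealr0 idealr1 mul0r; split.
  - move=> [r [s [sp sr rQ]]]; have /Qp := key _ _ _ _ _ sp sr sp (mul1r _) rQ.
    exact/negP.
  - move=> a u v [r [s [sp us rQ]]] [r' [s' [sp' vs rQ']]].
    have [b [t [tp at_]]] := localizationP a.
    exists (b * r * s' + r' * s * t), (s * s' * t).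
    rewrite !notin_primeM // to_localizationD !to_localizationM -us -vs -at_.
    split=> //; first by ring.
    have -> : b * r * s' + r' * s * t = b * s' * r + s * t * r' by ring.
    by rewrite rpredD ?idealMr.
  - move=> u v [r [s [sp uvs rQ]]].
    have [b [t [tp ut]]] := localizationP u.
    have [b' [t' [tp' vt]]] := localizationP v.
    have : b * b' \in Q.
      apply: (key (u * v) r s (b * b') (t * t')) => //; first exact: notin_primeM.
      by rewrite !to_localizationM -ut -vt; ring.
    rewrite prime_idealrM => /orP[bQ|bQ]; [left|right].
      by exists b, t.
    by exists b', t'.
exists Q' => r; apply/idP/idP => [/QQ'[r' [s [sp rs rQ]]]|rQ].
  by apply: (key (tl r) r' s r 1) => //; rewrite ?idealr1 ?mulr1.
by apply/QQ'; exists r, 1; rewrite idealr1 mulr1.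
Qed.

Lemma span_to_localization (s : seq R) r :
  span_ideal s r -> span_ideal (map tl s) (tl r).
Proof.
move: r; apply: span_sub => [|a u v|x /(nthP 0)[i si <-]].
- exact: span0.
- by rewrite to_localizationD to_localizationM; apply: spanD.
- by rewrite -(nth_map 0 0) //; apply: span_nth; rewrite size_map.
Qed.

Lemma span_of_localization (s : seq R) r : span_ideal (map tl s) (tl r) ->
  exists2 u, u \notin p & span_ideal s (u * r).
Proof.
pose P x := exists r t, [/\ t \notin p, x * tl t = tl r & span_ideal s r].
have sP : forall x, span_ideal (map tl s) x -> P x.
  apply: span_sub => [|a u v|_ /mapP[x xs ->]].
  - by exists 0, 1; rewrite idealr1 mul0r; split=> //; apply: span0.
  - move=> [b [t [tp ut sb]]] [b' [t' [tp' vt sb']]].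
    have [c [w [wp aw]]] := localizationP a.
    exists ((c * t') * b + (t * w) * b'), (t * t' * w).
    rewrite !notin_primeM // to_localizationD !to_localizationM -ut -vt -aw.
    by split=> //; [ring|apply: spanD => //; apply: spanM].
  - exists x, 1; rewrite idealr1 mulr1; split=> //.
    by have /(nthP 0)[i si <-] := xs; apply: span_nth.
move=> /sP[q [t [tp]]]; rewrite -to_localizationM.
move=> /to_localization_eq[u up] /eqP; rewrite mulrBr subr_eq0 => /eqP e sq.
exists (u * t); first exact: notin_primeM.
by rewrite -mulrA [t * r]mulrC e; apply: spanM.
Qed.

(** Regularity in [R] is asked only up to a multiplier [w] outside [p], which becomes a unit in the
    local ring. *)
Lemma regular_seq_localization (s : seq R) : {subset s <= p} ->
  (forall i y, (i < size s)%N -> span_ideal (take i s) (s`_i * y) ->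
     exists2 w, w \notin p & span_ideal (take i s) (w * y)) ->
  regular_seq (map tl s).
Proof.
move=> sp reg; split.
  move=> /(span_of_localization (r := 1))[u up].
  have : forall x, span_ideal s x -> x \in p.
    apply: span_sub => [|a x y xp yp|//]; first exact: idealr0.
    by rewrite rpredD ?idealMr.
  by move=> h /h; rewrite mulr1; apply/negP.
move=> i x; rewrite size_map => si; rewrite -map_take (nth_map 0) // => h.
have [r [t [tp xt]]] := localizationP x.
have : span_ideal (map tl (take i s)) (tl (s`_i * r)).
  by rewrite to_localizationM -xt mulrA [_ * tl t]mulrC; apply: spanM.
move=> /span_of_localization[u up]; rewrite mulrCA => /(reg _ _ si)[w wp].
move=> /span_to_localization; rewrite !to_localizationM -xt.
have [y1 e1] := to_localization_unit wp.
have [y2 e2] := to_localization_unit up.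
have [y3 e3] := to_localization_unit tp.
move=> /(spanM (y1 * y2 * y3)).
have -> : y1 * y2 * y3 * (tl w * (tl u * (x * tl t))) =
  (y1 * tl w) * (y2 * tl u) * (y3 * tl t) * x by ring.
by rewrite e1 e2 e3 !mul1r.
Qed.

End LocalizationTheory.

Section ToLocalizationMorphism.
Variables (R : comNzRingType) (p : prime_idealr R).

Fact to_localization_is_zmod_morphism : zmod_morphism (to_localization p).
Proof.
by move=> x y; apply: (addIr (to_localization p y)); rewrite -to_localizationD !subrK.
Qed.

Fact to_localization_is_monoid_morphism : monoid_morphism (to_localization p).
Proof. by split=> //; apply: to_localizationM. Qed.

HB.instance Definition _ := GRing.isZmodMorphism.Build R (localization p)
  (to_localization p) to_localization_is_zmod_morphism.
HB.instance Definition _ := GRing.isMonoidMorphism.Build R (localization p)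
  (to_localization p) to_localization_is_monoid_morphism.

End ToLocalizationMorphism.

(** * Stanley-Reisner rings *)

Section Substitution.
Variables (k : fieldType) (n : nat).
Local Notation S := {mpoly k[n]}.

Lemma mpoly_ringind (P : S -> Prop) :
  (forall c, P c%:MP) -> (forall i, P 'X_i) ->
  (forall f g, P f -> P g -> P (f + g)) ->
  (forall f g, P f -> P g -> P (f * g)) -> forall f, P f.
Proof.
move=> PC PX PD PM; elim/mpolyind => [|c m f _ _ Pf]; first by rewrite -mpolyC0.
apply: PD => //; rewrite -mul_mpolyC; apply: (PM) => //.
rewrite mpolyXE_id; elim/big_ind: _ => // [|i _]; first by rewrite -mpolyC1.
by elim: (m i) => [|l IH]; rewrite ?expr0 -?mpolyC1 // exprS; apply: PM.
Qed.

Lemma eq_mpoly_rmorph (B : nzRingType) (f g : {rmorphism S -> B}) :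
  (forall c, f c%:MP = g c%:MP) -> (forall i, f 'X_i = g 'X_i) -> f =1 g.
Proof.
move=> fgC fgX; apply: mpoly_ringind => // [x y|x y]; rewrite ?rmorphD ?rmorphM.
  by move=> -> ->.
by move=> -> ->.
Qed.

Lemma mmapXU (B : comNzRingType) (c : {rmorphism k -> B}) (h : 'I_n -> B) i :
  mmap c h 'X_i = h i.
Proof. by rewrite mmapX mmap1U. Qed.

(** The equation [restr F f = f] encodes that [f] is a polynomial in the variables of [F]. *)
Definition restr (F : {set 'I_n}) : S -> S :=
  mmap (@mpolyC n k) (fun i => if i \in F then 'X_i else 0).

HB.instance Definition _ F := GRing.RMorphism.on (restr F).

Lemma restrC F c : restr F c%:MP = c%:MP.
Proof. exact: mmapC. Qed.

Lemma restrX F i : restr F 'X_i = if i \in F then 'X_i else 0.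
Proof. exact: mmapXU. Qed.

Lemma restrI F G f : restr F (restr G f) = restr (F :&: G) f.
Proof.
apply: (eq_mpoly_rmorph (f := restr F \o restr G)) => /= [c|i].
  by rewrite !restrC.
by rewrite !restrX inE andbC; case: (i \in G); rewrite ?restrX ?rmorph0.
Qed.

(** Identifies the kernel of [restr F] with the ideal of the variables outside [F]. *)
Lemma restr_diff F f : exists c : 'I_n -> S,
  f = restr F f + \sum_(i | i \notin F) c i * 'X_i.
Proof.
elim/mpoly_ringind: f => [c|j|f g [c ec] [d ed]|f g [c ec] [d ed]].
- exists (fun=> 0); rewrite restrC big1 ?addr0 // => i _; exact: mul0r.
- rewrite restrX; have [jF|jF] := boolP (j \in F).
    by exists (fun=> 0); rewrite big1 ?addr0 // => i _; rewrite mul0r.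
  exists (fun i => (i == j)%:R); rewrite (bigD1 j) //= eqxx mul1r big1 ?addr0 ?add0r //.
  by move=> i /andP[_ /negPf->]; rewrite mul0r.
- exists (fun i => c i + d i); rewrite rmorphD {1}ec {1}ed.
  rewrite addrACA; congr (_ + _); rewrite -big_split.
  by apply: eq_bigr => i _; rewrite mulrDl.
(* Comes from [f g - f' g' = (f - f') g + f' (g - g')], with primes denoting restrictions. *)
- exists (fun i => c i * g + restr F f * d i).
  under eq_bigr do rewrite mulrDl mulrAC -[_ * d _ * _]mulrA.
  rewrite big_split /= -mulr_suml -mulr_sumr rmorphM.
  by rewrite addrCA -mulrDr -ed addrC -mulrDl -ec.
Qed.

End Substitution.

Section StanleyReisnerTheory.
Variables (k : fieldType) (n : nat) (D : complex 'I_n).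
Local Notation S := {mpoly k[n]}.
Local Notation R := (sr_ring k D).

Definition sr_pi (f : S) : R := \pi_({ideal_quot (sr_ideal (k := k) D)}) f.

Fact sr_pi_is_zmod_morphism : zmod_morphism sr_pi.
Proof. by move=> f g; rewrite /sr_pi rmorphB. Qed.

Fact sr_pi_is_monoid_morphism : monoid_morphism sr_pi.
Proof. by split=> [|f g]; rewrite /sr_pi ?rmorph1 // rmorphM. Qed.

HB.instance Definition _ :=
  GRing.isZmodMorphism.Build S R sr_pi sr_pi_is_zmod_morphism.
HB.instance Definition _ :=
  GRing.isMonoidMorphism.Build S R sr_pi sr_pi_is_monoid_morphism.

Lemma sr_piP (y : R) : exists f, y = sr_pi f.
Proof. by elim/quotW: y => f; exists f. Qed.

Lemma sr_pi_eq0 f : sr_pi f = 0 <-> f \in sr_ideal D.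
Proof.
have -> : (f \in sr_ideal D) = (f - 0 \in sr_ideal D) by rewrite subr0.
rewrite Quotient.idealrBE; split=> [e|/eqP].
  by apply/eqP; rewrite -[LHS]/(sr_pi f) e -[LHS](rmorph0 sr_pi).
by rewrite -[LHS]/(sr_pi f) -[RHS]/(sr_pi 0) rmorph0.
Qed.

Lemma sr_pi_nonface F : F \notin faces D -> sr_pi (face_monomial k F) = 0.
Proof.
move=> FD; apply/sr_pi_eq0/asboolP; exists (fun G => (G == F)%:R).
rewrite (bigD1 F) //= eqxx mul1r big1 ?addr0 // => G /andP[_ /negPf->].
by rewrite mul0r.
Qed.

Lemma sr_factor (B : nzRingType) (f : {rmorphism S -> B}) :
  (forall F, F \notin faces D -> f (face_monomial k F) = 0) ->
  forall x y, sr_pi x = sr_pi y -> f x = f y.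
Proof.
move=> fF x y xy; have : sr_pi (x - y) = 0 by rewrite rmorphB /= xy subrr.
move=> /sr_pi_eq0/asboolP[c e]; apply/eqP; rewrite -subr_eq0 -rmorphB e.
by rewrite rmorph_sum big1 // => F FD; rewrite rmorphM /= fF // mulr0.
Qed.

Lemma restr_nonface F G : F \in faces D -> G \notin faces D ->
  restr F (face_monomial k G) = 0.
Proof.
move=> FD GD; have [GF|/subsetPn[i iG iF]] := boolP (G \subset F).
  by rewrite (facesS GF FD) in GD.
by rewrite /face_monomial (bigD1 i) //= rmorphM /= restrX (negPf iF) mul0r.
Qed.

Lemma restr_sr F f g : F \in faces D -> sr_pi f = sr_pi g -> restr F f = restr F g.
Proof. by move=> FD; apply: sr_factor => G; apply: restr_nonface. Qed.

(** As [F] is a face, [restr F] factors through [R]; its values lie in a domain, so its kernel is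
    prime. *)
Lemma face_prime F : F \in faces D ->
  exists P : prime_idealr R, forall f, (sr_pi f \in P) = (restr F f == 0).
Proof.
move=> FD; pose Q (y : R) := exists2 f, y = sr_pi f & restr F f = 0.
have QP f : Q (sr_pi f) <-> restr F f = 0.
  by split=> [[g /(restr_sr FD)->]//|f0]; exists f.
have [|P PQ] := @prime_idealrP R Q.
  split.
  - by exists 0; rewrite rmorph0.
  - rewrite -(rmorph1 sr_pi) => /QP/eqP; rewrite rmorph1.
    by rewrite oner_eq0.
  - move=> a u v [f -> f0] [g -> g0]; have [h ->] := sr_piP a.
    exists (h * f + g); first by rewrite rmorphD rmorphM.
    by rewrite rmorphD rmorphM /= f0 g0 mulr0 addr0.
  - move=> u v; have [f ->] := sr_piP u; have [g ->] := sr_piP v.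
    rewrite -rmorphM => /QP/eqP; rewrite rmorphM mulf_eq0.
    by case/orP=> /eqP/QP; [left|right].
exists P => f; apply/idP/eqP => [/PQ/QP//|h]; exact/PQ/QP.
Qed.

Lemma restr_subset (F G : {set 'I_n}) (f : S) :
  F \subset G -> restr G f = 0 -> restr F f = 0.
Proof.
by move=> /setIidPl FG Gf; have := restrI F G f; rewrite Gf FG rmorph0.
Qed.

(** * Faces with a disconnected link of positive dimension *)

Section DisconnectedLink.
Variables (F U : {set 'I_n}) (v1 v2 x y : 'I_n).
Hypothesis sep : forall i j, i \in U -> j \notin U -> i \notin F -> j \notin F ->
  i |: (j |: F) \notin faces D.
Hypotheses (v1U : v1 \in U) (v1F : v1 \notin F) (v1D : v1 |: F \in faces D).
Hypotheses (v2U : v2 \notin U) (v2F : v2 \notin F) (v2D : v2 |: F \in faces D).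
Hypotheses (xF : x \notin F) (yF : y \notin F) (xy : x != y)
  (xyD : x |: (y |: F) \in faces D).

(** [U] separates the link of [F], with [v1] and [v2] on the two sides, which bounds the depth; the
    edge of [x] and [y] in the link bounds the dimension. *)
Lemma disconnected_link_depth : exists p : prime_idealr R,
  forall t d, local_depth (localization p) t -> krull_dim (localization p) d ->
  (t <= 1)%N /\ (2 <= d)%N.
Proof.
have FD : F \in faces D by apply: facesS v1D; apply: subsetUr.
have yD : y |: F \in faces D by apply: facesS xyD; apply: subsetUr.
have [p pE] := face_prime FD; exists p.
pose tl := to_localization p; pose q i := tl (sr_pi 'X_i).
(* A multiplier killing ['X_v] vanishes on the face [v |: F], hence on [F], so it lies in [p]. *)
have q_neq0 v : v \notin F -> v |: F \in faces D -> q v <> 0.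
  move=> vF vD; rewrite /q -[0](rmorph0 tl) => /to_localization_eq[u up].
  have [f fu] := sr_piP u; have [P PE] := face_prime vD.
  rewrite subr0 fu -rmorphM -[0](rmorph0 sr_pi) => /(restr_sr vD)/eqP.
  rewrite rmorphM rmorph0 /= mulf_eq0 restrX setU11.
  case/orP=> [/eqP f0|]; last first.
    move=> /eqP/(congr1 (mcoeff U_(v))); rewrite mcoeffXU eqxx mcoeff0 => /eqP.
    by rewrite oner_eq0.
  move: up; rewrite fu pE => /eqP; apply.
  by apply: restr_subset f0; apply: subsetUr.
have qq i j : i \in U -> j \notin U -> i \notin F -> j \notin F -> q i * q j = 0.
  move=> iU jU iF jF; rewrite /q -rmorphM -rmorphM -[RHS](rmorph0 tl).
  (* The monomial of [F] lies outside [p], and its product with ['X_i * 'X_j] is the monomial of a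
     non-face. *)
  apply/to_localization_eq; exists (sr_pi (face_monomial k F)).
    rewrite pE /face_monomial rmorph_prod prodf_seq_neq0.
    apply/allP=> l _; apply/implyP=> lF /=; rewrite restrX lF.
    apply/eqP=> /(congr1 (mcoeff U_(l))); rewrite mcoeffXU eqxx mcoeff0 => /eqP.
    by rewrite oner_eq0.
  rewrite subr0 -rmorphM; have := sr_pi_nonface (sep iU jU iF jF).
  rewrite /face_monomial big_setU1 /=; last first.
    by rewrite in_setU1 negb_or iF andbT; apply: contraNneq jU => <-.
  by rewrite big_setU1 //= => <-; rewrite mulrC -mulrA.
pose I1 (z : localization p) := exists c : 'I_n -> localization p,
  z = \sum_(i | (i \notin F) && (i \in U)) c i * q i.
pose I2 (z : localization p) := exists c : 'I_n -> localization p,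
  z = \sum_(i | (i \notin F) && (i \notin U)) c i * q i.
have depth1 (s : seq (localization p)) : (forall x, x \in s -> ~ invertible x) ->
    regular_seq s -> (size s <= 1)%N.
  apply: (@depth_le1 _ I1 I2 (q v1) (q v2)).
  - exact: localization_local.
  - move=> z zinv; have [r [s' [sp zs]]] := localizationP z.
    have [f rf] := sr_piP r.
    have := localization_ninv sp zs zinv; rewrite rf pE => /eqP f0.
    have [c] := restr_diff F f; rewrite f0 add0r => ef.
    have [w ws] := to_localization_unit sp.
    have zE : z = \sum_(i | i \notin F) (w * tl (sr_pi (c i))) * q i.
      rewrite -[z]mul1r -ws -mulrA [_ * z]mulrC zs rf ef !rmorph_sum mulr_sumr.
      by apply: eq_bigr => i _; rewrite /q -mulrA -!rmorphM.
    exists (\sum_(i | (i \notin F) && (i \in U)) (w * tl (sr_pi (c i))) * q i).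
    exists (\sum_(i | (i \notin F) && (i \notin U)) (w * tl (sr_pi (c i))) * q i).
    split; try by eexists.
    by rewrite zE (bigID (mem U)).
  - move=> _ _ [c ->] [d ->]; rewrite big_distrlr /=.
    apply: big1 => i /andP[iF iU]; apply: big1 => j /andP[jF jU].
    by rewrite mulrACA qq // mulr0.
  - exists (fun i => (i == v1)%:R); rewrite (bigD1 v1) /= ?v1F //.
    rewrite eqxx mul1r big1 ?addr0 // => i /andP[_ /negPf->]; exact: mul0r.
  - exact: q_neq0.
  - exists (fun i => (i == v2)%:R); rewrite (bigD1 v2) /= ?v2F //.
    rewrite eqxx mul1r big1 ?addr0 // => i /andP[_ /negPf->]; exact: mul0r.
  - exact: q_neq0.
move=> t d [[s [<- sinv sreg]] _] [_ maxd]; split; first exact: depth1.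
apply: maxd.
have [py pyE] := face_prime yD; have [px pxE] := face_prime xyD.
have sub_yF : {subset py <= p}.
  move=> r; have [f ->] := sr_piP r; rewrite pyE pE => /eqP f0.
  by apply/eqP; apply: restr_subset f0; apply: subsetUr.
have sub_xy : {subset px <= py}.
  move=> r; have [f ->] := sr_piP r; rewrite pxE pyE => /eqP f0.
  by apply/eqP; apply: restr_subset f0; apply: subsetUr.
have [Pp PpE] := @extend_prime _ p p (fun _ h => h).
have [Py PyE] := extend_prime sub_yF.
have [Px PxE] := extend_prime (fun r h => sub_yF r (sub_xy r h)).
(* Larger faces give smaller primes: the chain runs through [x |: (y |: F)], [y |: F] and [F]. *)
pose P i := if i == 0%N then Px else if i == 1%N then Py else Pp.
exists (fun i : 'I_3 => P i); apply: prime_chain_steps.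
have Xn0 v (G : {set 'I_n}) : (restr G ('X_v : S) == 0) = (v \notin G).
  rewrite restrX; case: ifP => _; last exact: eqxx.
  apply/negP=> /eqP/(congr1 (mcoeff U_(v))); rewrite mcoeffXU eqxx mcoeff0 => /eqP.
  by rewrite oner_eq0.
have ext_sub (Q Q' : prime_idealr R) (E E' : prime_idealr (localization p)) :
    (forall r, (tl r \in E) = (r \in Q)) -> (forall r, (tl r \in E') = (r \in Q')) ->
    {subset Q <= Q'} -> {subset E <= E'}.
  move=> QE QE' QQ z zE; have [r [s' [sp zs]]] := localizationP z.
  have [w ws] := to_localization_unit sp.
  rewrite -[z]mul1r -ws -mulrA [_ * z]mulrC zs idealMr // QE' QQ //.
  by rewrite -QE /tl -zs mulrC idealMr.
case=> [|[|//]] _; split.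
- exact: ext_sub sub_xy.
- exists (q x); rewrite /P /q /= ?PyE ?PxE ?pyE ?pxE Xn0 !inE ?eqxx //.
  by rewrite negb_or xy.
- exact: ext_sub sub_yF.
- by exists (q y); rewrite /P /q /= ?PyE ?PpE ?pyE ?pE Xn0 ?inE ?eqxx ?yF.
Qed.

End DisconnectedLink.

End StanleyReisnerTheory.

(** * Partition complexes *)

Lemma ideal_quotient (R : comNzRingType) (I : idealr R) :
  exists (K : comNzRingType) (f : {rmorphism R -> K}),
    forall x, (f x == 0) = (x \in I).
Proof.
exists {ideal_quot I}, (\pi_({ideal_quot I}) : {rmorphism R -> {ideal_quot I}}) => x.
by rewrite -[x in RHS]subr0 Quotient.idealrBE -[\pi 0]/(\pi 0) rmorph0.
Qed.

(** * Polynomials viewed in one chosen variable *)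

Section Univariate.
Variables (k : fieldType) (a : nat).
Local Notation A := {mpoly k[a]}.

Lemma restr_sub (F G : {set 'I_a}) (f : A) :
  F \subset G -> restr F f = f -> restr G f = f.
Proof. by move=> /setIidPr FG e; rewrite -{1}e restrI FG. Qed.

(** The coefficients stay in [A] instead of a ring with one variable fewer, so that evaluation at
    ['X_j] gives the polynomial back. *)
Definition univ (j : 'I_a) : A -> {poly A} :=
  mmap (polyC \o @mpolyC a k)
       (fun i => if i == j then 'X else ('X_i : A)%:P).

HB.instance Definition _ j := GRing.RMorphism.on (univ j).

Lemma univC j c : univ j c%:MP = c%:MP%:P.
Proof. exact: mmapC. Qed.

Lemma univX j i : univ j 'X_i = if i == j then 'X else ('X_i)%:P.
Proof. exact: mmapXU. Qed.

Lemma univK j g : (univ j g).['X_j] = g.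
Proof.
rewrite -[LHS]/(horner_eval 'X_j (univ j g)).
apply: (eq_mpoly_rmorph (f := horner_eval ('X_j : A) \o univ j) (g := idfun)).
  by move=> c /=; rewrite univC /horner_eval hornerC.
move=> i /=; rewrite univX /horner_eval.
by case: eqP => [->|_]; rewrite ?hornerX ?hornerC.
Qed.

Lemma univ_neq0 j g : g != 0 -> univ j g != 0.
Proof. by apply: contra_neq => e; rewrite -(univK j g) e horner0. Qed.

Lemma univ_coef (T : {set 'I_a}) j g m : j \notin T -> restr (j |: T) g = g ->
  restr T (univ j g)`_m = (univ j g)`_m.
Proof.
move=> jT gT; rewrite -coef_map -{2}gT /=; congr (polyseq _)`_m.
apply: (eq_mpoly_rmorph (f := map_poly (restr T) \o univ j)
                        (g := univ j \o restr (j |: T))) => [c|i] /=.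
  by rewrite univC restrC univC map_polyC /= restrC.
rewrite univX restrX in_setU1; case: eqP => [->|/eqP ij] /=.
  by rewrite univX eqxx map_polyX.
rewrite map_polyC /= restrX; case: ifP => _; last by rewrite polyC0 (rmorph0 (univ j)).
by rewrite univX (negPf ij).
Qed.

End Univariate.

(** Descending induction on [N]: modulo [J], the coefficient of index [N + D] of [p * q] is the
    [D]-th of [p] times the [N]-th of [q]. *)
Lemma poly_ideal_cancel (R : comNzRingType) (J : R -> Prop) (p q : {poly R}) D :
  J 0 -> (forall b u v, J u -> J v -> J (b * u + v)) ->
  (forall m, (D < m)%N -> p`_m = 0) -> (forall z, J (p`_D * z) -> J z) ->
  (forall N, J (p * q)`_N) -> forall N, J q`_N.
Proof.
move=> J0 JD pD Jp Jpq.
suff key t N : (size q <= N + t)%N -> J q`_N.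
  by move=> N; apply: (key (size q)); rewrite leq_addl.
elim: t N => [|t IH] N sz; first by rewrite nth_default // -[N]addn0.
have Jbig M : (N < M)%N -> J q`_M.
  by move=> NM; apply: IH; apply: leq_trans sz _; rewrite addnS -addSn leq_add2r.
apply: Jp; have DN : (D < (N + D).+1)%N by rewrite ltnS leq_addl.
have := Jpq (N + D)%N; rewrite coefM (bigD1 (Ordinal DN)) //= addnK => JS.
have JE : J (\sum_(i < (N + D).+1 | i != Ordinal DN) p`_i * q`_(N + D - i)).
  elim/big_ind: _ => // [u v Ju Jv|i iD]; first by rewrite -[u]mul1r; apply: JD.
  rewrite -[X in J X]addr0; case: (ltngtP i D) => [ltiD|ltDi|eiD].
  - apply: (JD) => //; apply: Jbig.
    by rewrite -addnBA ?(ltnW ltiD) // -[N.+1]addn1 leq_add2l subn_gt0.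
  - by rewrite pD // mul0r addr0.
  - by case/eqP: iD; apply: val_inj.
by have := JD _ _ _ JE JS => /(_ (-1)); rewrite mulN1r addrCA addNr addr0.
Qed.

(* An element annihilated by a polynomial with leading coefficient [c] becomes
   integral after multiplication by [c]. *)
Lemma integral_multiple (k : fieldType) (a : nat) (K : comNzRingType)
    (tau : {rmorphism {mpoly k[a]} -> K}) (T : {set 'I_a}) :
  (forall d, restr T d = d -> d != 0 -> tau d != 0) ->
  (forall j, j \notin T ->
    exists g, [/\ restr (j |: T) g = g, g != 0 & tau g = 0]) ->
  forall q, exists d, [/\ restr T d = d, d != 0
    & integralOver (tau \o restr T) (tau (d * q))].
Proof.
move=> indep dep q.
pose tauT : {rmorphism {mpoly k[a]} -> K} := tau \o restr T.
have restr1 : restr T (1 : {mpoly k[a]}) = 1 by rewrite rmorph1.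
have int_T d : restr T d = d -> integralOver tauT (tau d).
  by move=> dT; rewrite -dT; apply: (integral_id tauT).
rewrite -/tauT.
elim/mpoly_ringind: q => [c|j|f g|f g].
- exists 1; rewrite restr1 oner_neq0 mul1r; split=> //.
  by apply: int_T; rewrite restrC.
- have [jT|jT] := boolP (j \in T).
    exists 1; rewrite restr1 oner_neq0 mul1r; split=> //.
    by apply: int_T; rewrite restrX jT.
  have [g [gT g0 gQ]] := dep j jT.
  pose p := univ j g; pose c := lead_coef p.
  have pT m : restr T p`_m = p`_m by apply: univ_coef.
  have p0 : p != 0 by apply: univ_neq0.
  have c0 : c != 0 by rewrite lead_coef_eq0.
  exists c; split=> //; first exact: pT.
  (* Were [p] constant, [g] would be a nonzero polynomial in the variables of [T] killed by
     [tau]. *)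
  have [e szp] : exists e, size p = e.+2.
    case E : (size p) => [|[|m]]; last by exists m.
      by move/eqP: E; rewrite size_poly_eq0 (negPf p0).
    have /eqP[] := indep c (pT _) c0; rewrite -gQ.
    by rewrite -(univK j g) -/p (size1_polyC (eq_leq E)) hornerC /c lead_coefE E.
  (* Multiplying the relation [g] by [c ^+ e] makes it monic in [c * 'X_j]. *)
  exists ('X^(e.+1) + \poly_(m < e.+1) (c ^+ (e - m) * p`_m)).
    by rewrite monicE lead_coefDl ?lead_coefXn // size_polyXn ltnS size_poly.
  apply/rootP; rewrite rmorphD /= map_polyXn hornerD hornerXn.
  rewrite poly_def rmorph_sum /= horner_sum -(rmorphXn tau).
  have -> : \sum_(m < e.+1)
      (map_poly tauT ((c ^+ (e - m) * p`_m) *: 'X^m)).[tau (c * 'X_j)] =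
      tau (\sum_(m < e.+1) c ^+ (e - m) * p`_m * (c * 'X_j) ^+ m).
    rewrite rmorph_sum; apply: eq_bigr => m _.
    rewrite map_polyZ map_polyXn hornerZ hornerXn.
    rewrite [in RHS](rmorphM tau) [in RHS](rmorphXn tau).
    congr (_ * _); rewrite -[LHS]/(tau (restr T _)).
    by rewrite (rmorphM (restr T)) (rmorphXn (restr T)) /= !pT.
  rewrite -rmorphD; have -> : (c * 'X_j) ^+ e.+1 +
      \sum_(m < e.+1) c ^+ (e - m) * p`_m * (c * 'X_j) ^+ m = c ^+ e * g.
    rewrite -(univK j g) -/p horner_coef szp [in RHS]big_ord_recr /= mulrDr addrC.
    congr (_ + _).
      rewrite mulr_sumr; apply: eq_bigr => m _.
      have me : (m <= e)%N by rewrite -ltnS.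
      have -> : c ^+ e = c ^+ (e - m) * c ^+ m by rewrite -exprD subnK.
      by rewrite exprMn; ring.
    by rewrite exprMn exprS /c lead_coefE szp /=; ring.
  by rewrite rmorphM gQ mulr0.
- move=> [d [dT d0 df]] [d' [dT' d0' dg]]; exists (d * d').
  split; [by rewrite rmorphM /= dT dT'|exact: mulf_neq0|].
  have -> : d * d' * (f + g) = d' * (d * f) + d * (d' * g) by ring.
  rewrite (rmorphD tau) !(rmorphM tau _ (_ * _)).
  by apply: integral_add; apply: integral_mul => //; apply: int_T.
- move=> [d [dT d0 df]] [d' [dT' d0' dg]]; exists (d * d').
  split; [by rewrite rmorphM /= dT dT'|exact: mulf_neq0|].
  by rewrite mulrACA rmorphM; apply: integral_mul.
Qed.

(** * Complexes whose faces have at most one vertex of each colour *)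

Section PartitionComplex.
Variables (k : fieldType) (n a : nat) (chi : 'I_n -> 'I_a) (D : complex 'I_n).
Hypothesis chi_onto : forall j, exists i, chi i = j.
Hypothesis D_chi : forall F : {set 'I_n},
  F \in faces D <-> {in F &, injective chi}.
Local Notation S := {mpoly k[n]}.
Local Notation A := {mpoly k[a]}.
Local Notation R := (sr_ring k D).
Local Notation x_ := (fun i => @sr_pi k n D 'X_i).

Lemma colour_mul0 i l : i != l -> chi i = chi l -> x_ i * x_ l = 0.
Proof.
move=> il e; rewrite -rmorphM.
have : [set i; l] \notin faces D.
  apply/negP=> /D_chi/(_ i l); rewrite !inE !eqxx orbT => /(_ isT isT e)/eqP.
  exact/negP.
move=> /(sr_pi_nonface k); rewrite /face_monomial big_setU1 ?inE //.
by rewrite big_set1.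
Qed.

Definition theta : A -> S :=
  mmap (@mpolyC n k) (fun j => \sum_(i | chi i == j) 'X_i).

HB.instance Definition _ := GRing.RMorphism.on theta.

Definition ev : A -> R := @sr_pi k n D \o theta.

HB.instance Definition _ := GRing.RMorphism.on ev.

Lemma thetaC c : theta c%:MP = c%:MP.
Proof. exact: mmapC. Qed.

Lemma thetaX j : theta 'X_j = \sum_(i | chi i == j) 'X_i.
Proof. exact: mmapXU. Qed.

(** Modulo a prime at most one variable of each colour survives, and it then equals its colour
    sum. *)
Lemma ev_surj (Q : prime_idealr R) y : exists q, y - ev q \in Q.
Proof.
have /choice[c cP] : forall j, exists c, chi c = j /\
    forall i, chi i = j -> i != c -> x_ i \in Q.
  move=> j; have [[c [cj cQ]]|nc] := pselect (exists c, chi c = j /\ x_ c \notin Q).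
    exists c; split=> // i ij ic.
    have : x_ i * x_ c \in Q by rewrite colour_mul0 ?idealr0 // ij cj.
    by rewrite prime_idealrM (negPf cQ) orbF.
  have [c cj] := chi_onto j; exists c; split=> // i ij _.
  by apply: contrapT => /negP iQ; apply: nc; exists i.
have [f ->] := sr_piP y.
elim/mpoly_ringind: f => [b|i|f g [q qf] [r rg]|f g [q qf] [r rg]].
- by exists b%:MP; rewrite /ev /= thetaC subrr idealr0.
- have [ci cQ] := cP (chi i); have [ic|ic] := eqVneq i (c (chi i)).
    exists 'X_(chi i); rewrite /ev /= thetaX rmorph_sum (bigD1 i) //=.
    rewrite opprD addNKr rpredN rpred_sum // => l /andP[/eqP li nli].
    by apply: cQ => //; rewrite -ic.
  by exists 0; rewrite rmorph0 subr0 cQ.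
- by exists (q + r); rewrite !rmorphD /= opprD addrACA rpredD.
- exists (q * r); rewrite !rmorphM /=.
  have -> : sr_pi D f * sr_pi D g - ev q * ev r =
    sr_pi D f * (sr_pi D g - ev r) + ev r * (sr_pi D f - ev q) by ring.
  by rewrite rpredD ?idealMr.
Qed.

Definition indep (P : prime_idealr R) (T : {set 'I_a}) : Prop :=
  forall q, restr T q = q -> q != 0 -> ev q \notin P.

(* Otherwise R / Q, which is generated by the images of the theta_j, is integral
   up to denominators over k[theta_T]; the constant term of an equation of
   integral dependence of [x] is then an element of k[theta_T] lying in [Q']. *)
Lemma indep_extend (Q Q' : prime_idealr R) (T : {set 'I_a}) x :
  {subset Q <= Q'} -> x \in Q' -> x \notin Q -> indep Q' T ->
  exists2 j, j \notin T & indep Q (j |: T).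
Proof.
move=> QQ' xQ' xQ indT; apply: contrapT => nex.
have dep j : j \notin T -> exists g,
    [/\ restr (j |: T) g = g, g != 0 & ev g \in Q].
  move=> jT; apply: contrapT => ng; apply: nex; exists j => // g gT g0.
  by apply/negP=> gQ; apply: ng; exists g.
have [K [pi piE]] := ideal_quotient Q.
pose tau : {rmorphism A -> K} := pi \o ev.
have tau0 q : (tau q == 0) = (ev q \in Q) by exact: piE.
have indQ d : restr T d = d -> d != 0 -> tau d != 0.
  by move=> dT d0; rewrite tau0; apply: contra (indT d dT d0) => /QQ'.
have depK j : j \notin T -> exists g, [/\ restr (j |: T) g = g, g != 0 & tau g = 0].
  by move=> /dep[g [gT g0 gQ]]; exists g; split=> //; apply/eqP; rewrite tau0.
have [q xq] := ev_surj Q x.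
have qQ' : ev q \in Q'.
  by rewrite -[ev q](subKr x) rpredB // QQ'.
have qQ : ev q \notin Q.
  by apply: contra xQ => qQ; rewrite -[x](subrK (ev q)) rpredD.
have [d [dT d0 [P Pmon Proot]]] := integral_multiple indQ depK q.
pose y := d * q.
have yQ' : ev y \in Q' by rewrite rmorphM idealMr.
have yQ : ev y \notin Q.
  rewrite rmorphM prime_idealrM negb_or qQ andbT.
  by apply: contra (indT d dT d0) => /QQ'.
(* A nonzero constant term would be forced into [Q'], against independence; if it is zero, a factor
   [y], outside the prime [Q], splits off. *)
have noroot (p : {poly A}) : p != 0 -> (forall m, restr T p`_m = p`_m) ->
    ev p.[y] \notin Q.
  elim/poly_ind: p => [|p c IH]; first by rewrite eqxx.
  move=> p0 pT; have cT : restr T c = c.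
    by have := pT 0%N; rewrite coefD coefMX coefC add0r.
  have [c0|c0] := eqVneq c 0; last first.
    rewrite hornerMXaddC rmorphD rmorphM; apply: contra (indT c cT c0) => h.
    have -> : ev c = (ev p.[y] * ev y + ev c) - ev p.[y] * ev y by ring.
    by rewrite rpredB ?idealMr // QQ'.
  rewrite c0 addr0 hornerMX rmorphM prime_idealrM negb_or yQ andbT.
  move: p0 pT; rewrite c0 addr0 => p0 pT; apply: IH.
    by apply: contraNneq p0 => ->; rewrite mul0r.
  by move=> m; have := pT m.+1; rewrite coefMX.
have /negP[] : ev (map_poly (restr T) P).[y] \notin Q.
  apply: noroot => [|m]; last by rewrite coef_map /= restrI setIid.
  by apply: monic_neq0; apply: monic_map.
by rewrite /root map_poly_comp horner_map tau0 in Proot.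
Qed.

(** Kills the other vertices of the colour of [i] and frees ['X_i] as an indeterminate, so that
    degree arguments in one vertex apply to elements of [R]. *)
Definition slice (i : 'I_n) : S -> {poly R} :=
  mmap (polyC \o (@sr_pi k n D \o @mpolyC n k))
       (fun l => if l == i then 'X else
                 if chi l == chi i then 0 else (x_ l)%:P).

HB.instance Definition _ i := GRing.RMorphism.on (slice i).

Lemma sliceC i c : slice i c%:MP = (sr_pi D c%:MP)%:P.
Proof. exact: mmapC. Qed.

Lemma sliceX i l : slice i 'X_l =
  if l == i then 'X else if chi l == chi i then 0 else (x_ l)%:P.
Proof. exact: mmapXU. Qed.

(** A non-face has two vertices of one colour: in the colour of [i] one of them is killed, in any
    other their product already vanishes in [R]. *)
Lemma slice_sr i f g : sr_pi D f = sr_pi D g -> slice i f = slice i g.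
Proof.
apply: sr_factor => F /negP FD.
have [l [l' [lF l'F e ll']]] : exists l l',
    [/\ l \in F, l' \in F, chi l = chi l' & l != l'].
  apply: contrapT => nex; apply/FD/D_chi => l l' lF l'F e; apply/eqP/negPn/negP => ll'.
  by apply: nex; exists l, l'.
have l'Fl : l' \in F :\ l by rewrite in_setD1 eq_sym ll'.
rewrite /face_monomial (big_setD1 l lF) (big_setD1 l' l'Fl) /=.
rewrite !rmorphM /= mulrA !sliceX -e; case: (eqVneq l i) => [li|li]; last first.
  case: (eqVneq (chi l) (chi i)) => [_|ne]; first by rewrite !mul0r.
  have [l'i|l'i] := eqVneq l' i; first by rewrite e l'i eqxx in ne.
  by rewrite -polyCM colour_mul0 // mul0r.
by rewrite -li eq_sym (negPf ll') eqxx mulr0 mul0r.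
Qed.

Lemma slice_theta_const i h : restr [set~ chi i] h = h ->
  slice i (theta h) = (ev h)%:P.
Proof.
move=> <-.
apply: (eq_mpoly_rmorph (f := (slice i \o theta) \o restr [set~ chi i])
                (g := (polyC \o ev) \o restr [set~ chi i])) => [c|j] /=.
  by rewrite restrC /ev /= thetaC sliceC.
rewrite restrX !inE; case: eqP => [_|/eqP ji] /=; first by rewrite !rmorph0.
rewrite /ev /= thetaX !rmorph_sum; apply: eq_bigr => l /eqP lj /=.
rewrite sliceX lj (negPf ji); case: eqP => // li.
by rewrite -lj li eqxx in ji.
Qed.

Lemma slice_theta i g : slice i (theta g) = map_poly ev (univ (chi i) g).
Proof.
apply: (eq_mpoly_rmorph (f := slice i \o theta)
                        (g := map_poly ev \o univ (chi i))) => [c|j] /=.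
  by rewrite thetaC sliceC univC map_polyC /= /ev /= thetaC.
rewrite univX thetaX rmorph_sum; have [->|ji] := eqVneq j (chi i).
  rewrite map_polyX (bigD1 i) //= sliceX eqxx big1 ?addr0 // => l /andP[/eqP li lni].
  by rewrite sliceX (negPf lni) li eqxx.
rewrite map_polyC /= /ev /= thetaX !rmorph_sum; apply: eq_bigr => l /eqP lj /=.
rewrite sliceX lj (negPf ji); case: eqP => // li.
by rewrite -lj li eqxx in ji.
Qed.

(* A monomial outside the ideal involves at most one variable of each colour,
   hence the element is recovered from its slices in the colour [j]. *)
Lemma slice_eval j f : exists r, forall i0, chi i0 = j ->
  r = (slice i0 f)`_0 /\
  sr_pi D f = r + \sum_(i | chi i == j) ((slice i f).[x_ i] - r).
Proof.
pose C := [set l | chi l != j].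
have sl0 i : chi i = j -> (slice i f)`_0 = sr_pi D (restr C f).
  move=> ij; rewrite -horner_coef0 -[LHS]/(horner_eval 0 (slice i f)).
  apply: (eq_mpoly_rmorph (f := horner_eval (0 : R) \o slice i)
                          (g := sr_pi D \o restr C)) => [c|l] /=.
    by rewrite /horner_eval sliceC hornerC restrC.
  rewrite /horner_eval sliceX restrX inE; have [->|li] := eqVneq l i.
    by rewrite hornerX ij eqxx rmorph0.
  by rewrite ij; case: eqP => _ /=; rewrite hornerC ?rmorph0.
have sl i : chi i = j -> (slice i f).[x_ i] = sr_pi D (restr (i |: C) f).
  move=> ij; rewrite -[LHS]/(horner_eval (x_ i) (slice i f)).
  apply: (eq_mpoly_rmorph (f := horner_eval (x_ i) \o slice i)
                          (g := sr_pi D \o restr (i |: C))) => [c|l] /=.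
    by rewrite /horner_eval sliceC hornerC restrC.
  rewrite /horner_eval sliceX restrX !inE; have [->|li] := eqVneq l i.
    by rewrite hornerX.
  by rewrite ij; case: eqP => _ /=; rewrite hornerC ?rmorph0.
(* [r] is the part of [f] free of the colour [j]; each summand is the part carried by one vertex of
   that colour. *)
exists (sr_pi D (restr C f)) => i0 i0j; rewrite sl0 //; split=> //.
have inC l : (l \notin C) = (chi l == j) by rewrite inE negbK.
have mulX i l (c : S) : chi i = j -> chi l = j -> l != i ->
    sr_pi D (c * 'X_l) * x_ i = 0.
  by move=> ij lj li; rewrite rmorphM -mulrA colour_mul0 ?mulr0 // ij lj.
have restr_mulX i (h : S) : chi i = j ->
    sr_pi D (restr (i |: C) h * 'X_i) = sr_pi D (h * 'X_i).
  move=> ij; have [c {2}->] := restr_diff (i |: C) h.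
  rewrite mulrDl rmorphD /= -[LHS]addr0; congr (_ + _).
  rewrite mulr_suml rmorph_sum big1 // => l.
  rewrite in_setU1 negb_or inC => /andP[li /eqP lj].
  by rewrite rmorphM /= mulX.
have [c fE] := restr_diff C f.
have slE i : chi i = j ->
    sr_pi D (restr (i |: C) f) = sr_pi D (restr C f) + sr_pi D (c i * 'X_i).
  move=> ij; rewrite {1}fE rmorphD /= restrI (setIidPr (subsetUr _ _)) rmorphD /=.
  congr (_ + _); rewrite (rmorph_sum (restr _)) (rmorph_sum (@sr_pi k n D)).
  rewrite (bigD1 i) /=; last by rewrite inC ij.
  rewrite big1 ?addr0; [|move=> l /andP[lC li]].
    by rewrite rmorphM /= restrX setU11 restr_mulX.
  by rewrite rmorphM /= restrX in_setU1 (negPf li) (negPf lC) mulr0 rmorph0.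
rewrite {1}fE rmorphD; congr (_ + _); rewrite rmorph_sum.
apply: eq_big => [l|l lC]; first exact: inC.
have lj : chi l = j by apply/eqP; rewrite -inC.
by rewrite sl // slE // addrC addKr.
Qed.

(** The generators do not involve the colour of [i], so they slice to constants and membership
    passes to each coefficient. *)
Lemma slice_span i (G : seq A) h : (forall q, q \in G -> restr [set~ chi i] q = q) ->
  span_ideal (map ev G) (sr_pi D h) ->
  forall N, span_ideal (map ev G) (slice i h)`_N.
Proof.
move=> Gi hG.
suff /(_ _ hG _ erefl) : forall z, span_ideal (map ev G) z ->
  forall h, z = sr_pi D h -> forall N, span_ideal (map ev G) (slice i h)`_N by [].
apply: span_sub => [h' e|b u v Pu Pv h' e|_ /mapP[q qG ->] h' /slice_sr<-] N.
- have /slice_sr<- : sr_pi D (0 : S) = sr_pi D h' by rewrite rmorph0.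
  by rewrite rmorph0 coef0; apply: span0.
- have [[[b' bE] [u' uE]] [v' vE]] := (sr_piP b, sr_piP u, sr_piP v).
  have /slice_sr<- : sr_pi D (b' * u' + v') = sr_pi D h'.
    by rewrite -e bE uE vE rmorphD rmorphM.
  rewrite rmorphD rmorphM coefD coefM; apply: span_add; last exact: Pv.
  by elim/big_ind: _ => [|s t|l _]; [exact: span0|exact: span_add|apply/spanM/Pu].
- rewrite slice_theta_const ?Gi // coefC; case: eqP => _; last exact: span0.
  have /(nthP 0)[l lG <-] : ev q \in map ev G by apply: map_f.
  exact: span_nth.
Qed.

(* The ideal [J] is the saturation of the span by k[theta_T] minus 0. In each
   slice, [ev g] is a polynomial in one variable whose leading coefficient is
   invertible modulo [J], so it can be cancelled there. *)
Lemma regular_step (T : {set 'I_a}) j (G : seq A) g y : j \notin T ->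
  (forall q, q \in G -> restr [set~ j] q = q) ->
  restr (j |: T) g = g -> g != 0 ->
  span_ideal (map ev G) (ev g * y) ->
  exists w, [/\ restr T w = w, w != 0 & span_ideal (map ev G) (ev w * y)].
Proof.
move=> jT Gj gT g0 gy.
pose J z := exists w, [/\ restr T w = w, w != 0 & span_ideal (map ev G) (ev w * z)].
have span_J z : span_ideal (map ev G) z -> J z.
  by move=> sz; exists 1; rewrite !rmorph1 oner_neq0 mul1r.
have J0 : J 0 by apply/span_J/span0.
have JD b u v : J u -> J v -> J (b * u + v).
  move=> [w [wT w0 wu]] [w' [wT' w0' wv]]; exists (w * w').
  rewrite rmorphM /= wT wT' mulf_neq0 // rmorphM /=; split=> //.
  have -> : ev w * ev w' * (b * u + v) =
    (ev w' * b) * (ev w * u) + ev w * (ev w' * v) by ring.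
  by apply: spanD => //; apply: spanM.
have [f fy] := sr_piP y.
have Jslice i : chi i = j -> forall N, J (slice i f)`_N.
  move=> ij; pose p := univ j g.
  apply: (@poly_ideal_cancel _ J (map_poly ev p) _ (size p).-1) => //.
  - move=> m ms; rewrite coef_map nth_default ?raddf0 //.
    exact: leq_trans (leqSpred _) ms.
  - move=> z [w [wT w0 wz]]; exists (w * lead_coef p).
    rewrite rmorphM /= wT lead_coefE univ_coef // -lead_coefE.
    rewrite mulf_neq0 ?lead_coef_eq0 ?univ_neq0 //; split=> //.
    by rewrite rmorphM /= -mulrA lead_coefE -coef_map.
  - move=> N; rewrite /p -ij -slice_theta -rmorphM; apply/span_J.
    apply: slice_span; first by rewrite ij.
    by rewrite rmorphM /= -fy.
suff : J y by [].
have [r rP] := slice_eval j f.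
have [i0 i0j] := chi_onto j; have [r0 fE] := rP i0 i0j.
have Jr : J r by rewrite r0; apply: Jslice.
have Jadd u v : J u -> J v -> J (u + v).
  by move=> Ju Jv; rewrite -[u]mul1r; apply: JD.
have Jmul b u : J u -> J (b * u).
  by move=> Ju; rewrite -[b * u]addr0; apply: JD.
rewrite fy fE; apply: (Jadd) => //; elim/big_ind: _ => // i /eqP ij.
apply: (Jadd); last by rewrite -mulN1r; apply: Jmul.
rewrite horner_coef; elim/big_ind: _ => // l _.
by rewrite mulrC; apply: Jmul; apply: Jslice.
Qed.

Theorem partition_complex_cm : cohen_macaulay R.
Proof.
move=> p.
have ind0 : indep p set0.
  move=> q q0 qn0.
  have [c qc] : exists c, restr set0 q = c%:MP.
    elim/mpoly_ringind: (q) => [c|i|f g [c fc] [d gd]|f g [c fc] [d gd]].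
    - by exists c; rewrite restrC.
    - by exists 0; rewrite restrX inE mpolyC0.
    - by exists (c + d); rewrite rmorphD /= fc gd mpolyCD.
    - by exists (c * d); rewrite rmorphM /= fc gd mpolyCM.
  rewrite -q0 qc in qn0 *.
  have c0 : c != 0 by apply: contra_neq qn0 => ->; rewrite mpolyC0.
  apply/negP=> /(idealMr (ev (c^-1)%:MP)); rewrite -rmorphM -mpolyCM mulVf //.
  by rewrite mpolyC1 rmorph1 idealr1.
have [T Tmax] :=
  @ex_maxset _ (fun T => `[< indep p T >]) (ex_intro _ set0 (asboolT ind0)).
have indT : indep p T by have /asboolP := maxsetp Tmax.
have dep j : j \notin T -> exists g,
    [/\ restr (j |: T) g = g, g != 0 & ev g \in p].
  move=> jT; apply: contrapT => ng.
  have indj : indep p (j |: T).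
    by move=> g gT g0; apply/negP=> gp; apply: ng; exists g.
  have := maxsetsup Tmax (asboolT indj) (subsetUr _ _) => e.
  by rewrite -e setU11 in jT.
exists #|~: T|.
have /choice[g gP] : forall j, exists g, j \notin T ->
    [/\ restr (j |: T) g = g, g != 0 & ev g \in p].
  by move=> j; have [_|/dep[g gP]] := boolP (j \in T); [exists 0|exists g].
pose s := map ev (map g (enum (~: T))).
have sp : {subset s <= p}.
  move=> _ /mapP[_ /mapP[j + ->] ->]; rewrite mem_enum inE => /gP[_ _].
  exact.
apply: (@depth_eq_dim _ _ (map (to_localization p) s)).
- by rewrite !size_map cardE.
- by move=> _ /mapP[r /sp rp ->]; apply: to_localization_ninv.
- apply: regular_seq_localization => // i y.
  rewrite !size_map => si; rewrite -!map_take.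
  have [j0 _] : exists j0 : 'I_a, True.
    by case: (enum _) si => // j0; exists j0.
  have jE := mem_nth j0 si; set j := nth j0 _ i in jE.
  have jT : j \notin T by move: jE; rewrite mem_enum inE.
  have [gT g0 _] := gP j jT.
  have -> : s`_i = ev (g j).
    by rewrite /s -map_comp (nth_map j0).
  move=> /(regular_step jT _ gT g0)[|w [wT w0 wy]]; last first.
    by exists (ev w) => //; apply: indT.
  (* Earlier relations avoid the variable [j]: they live in [l |: T] with [l] before [j] in a
     duplicate-free enumeration. *)
  move=> _ /mapP[l lE ->].
  have lT : l \notin T by move: (mem_take lE); rewrite mem_enum inE.
  have [gl _ _] := gP l lT; apply: restr_sub gl.
  apply/subsetP=> t; rewrite !inE => /orP[/eqP->|]; last by apply: contraTneq => ->.
  apply: contraTneq lE => ->.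
  by rewrite in_take // index_uniq ?enum_uniq // ltnn.
- move=> e P /contract_chain[P' [P'ch P'p]].
  (* [i] counts steps down from the top of the chain; each strict inclusion adjoins one more
     index. *)
  have grow i : (i <= e)%N -> exists2 T' : {set 'I_a},
      indep (P' (inord (e - i))) T' & (#|T| + i <= #|T'|)%N.
    elim: i => [_|i IH ie].
      exists T; last by rewrite addn0.
      by move=> q qT q0; apply: contra (indT q qT q0); apply: P'p.
    have [T' indT' cT'] := IH (ltnW ie).
    have [|sub [x xi xn]] := P'ch (inord (e - i.+1)) (inord (e - i)).
      by rewrite !inordK ?ltnS ?leq_subr // ltn_sub2l.
    have [j jT' indj] := indep_extend sub xi xn indT'.
    by exists (j |: T') => //; rewrite cardsU1 jT' addnS add1n ltnS.
  have [T' _] := grow e (leqnn e).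
  move=> le; have := leq_trans le (max_card _); rewrite card_ord => le_a.
  by rewrite cardsCs setCK card_ord leq_subRL // -[X in (_ <= X)%N]card_ord max_card.
Qed.

End PartitionComplex.

(** * One-paired circulant graphs *)

Local Open Scope nat_scope.

Section OnePaired.
Variables (n a b : nat).
Hypotheses (a_gt0 : 0 < a) (b_gt1 : 1 < b) (ab_dvd_n : a * b %| n).

Lemma dvdn_dist d i j : (d %| `|(i%:Z - j%:Z)%R|) = (i == j %[mod d]).
Proof.
wlog le_ij : i j / i <= j => [th|].
  by have [/th//|/ltnW/th] := leqP i j; rewrite distnC eq_sym.
by rewrite distnEr // eq_sym eqn_mod_dvd.
Qed.

(** As [a] and [a * b] divide [n], a distance and its complement to [n] pass the same divisibility
    tests, and for distinct vertices one of them is at most [n./2]. *)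
Lemma one_pairedE (i j : 'I_n) :
  one_paired n a b i j = (i == j %[mod a]) && (i != j %[mod a * b]).
Proof.
rewrite -!dvdn_dist /one_paired /= /circulant_rel.
set d := `|_|.
have dn : d < n.
  rewrite /d; have [ij|/ltnW ij] := leqP i j.
    by rewrite distnEr // (leq_ltn_trans (leq_subr _ _)).
  by rewrite distnEl // (leq_ltn_trans (leq_subr _ _)).
rewrite -!topredE /= /one_paired_set.
have an : a %| n by apply: dvdn_trans ab_dvd_n; apply: dvdn_mulr.
rewrite !(dvdn_subr (ltnW dn)) // -!andb_orl -[RHS]andTb.
have [d0|d_gt0] := posnP d; first by rewrite d0 !dvdn0 !andbF.
congr (_ && _); rewrite subn_gt0 dn /=.
by clearbody d; rewrite !geq_half_double; lia.
Qed.

Lemma one_paired_face (F : {set 'I_n}) : F \in faces (Ind (one_paired n a b)) <->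
  {in F &, forall i j : 'I_n, i = j %[mod a] -> i = j %[mod a * b]}.
Proof.
rewrite inE; split=> [/forall_inP h i j iF jF /eqP e|h].
  have := forall_inP (h i iF) j jF.
  by rewrite one_pairedE e /= negbK => /eqP.
apply/forall_inP=> i iF; apply/forall_inP=> j jF.
rewrite one_pairedE negb_and negbK; case: eqP => //= e.
by apply/eqP/h.
Qed.

Hypothesis ab_lt_n : a * b < n.

Lemma one_paired_not_S2 (k : fieldType) :
  exists p : prime_idealr (sr_ring k (Ind (one_paired n a b))),
  forall t d, local_depth (localization p) t -> krull_dim (localization p) d ->
  t <= 1 /\ 2 <= d.
Proof.
have a_ab : a < a * b by rewrite -[X in X < _]muln1 ltn_pmul2l.
have ab0 : 0 < a * b by apply: leq_trans a_ab.
have n0 : 0 < n by apply: leq_trans ab_lt_n.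
have an : a < n by apply: ltn_trans ab_lt_n.
(* [F] takes, for each nonzero residue [r] modulo [a], the part of residue [r] modulo [a * b]; its
   link lives on the multiples of [a], and [U] is one part there. *)
pose F := [set i : 'I_n | 0 < i %% (a * b) < a].
pose U := [set i : 'I_n | i %% (a * b) == 0].
pose o0 : 'I_n := Ordinal n0; pose oa : 'I_n := Ordinal an.
pose oab : 'I_n := Ordinal ab_lt_n.
have modab (i : nat) : i %% (a * b) %% a = i %% a by rewrite modn_dvdm ?dvdn_mulr.
have small (X : {set 'I_n}) : (forall i, i \in X -> i %% (a * b) < a) ->
    X \in faces (Ind (one_paired n a b)).
  move=> Xa; apply/one_paired_face => i j iX jX.
  by rewrite -modab -(modab j) (modn_small (Xa i iX)) (modn_small (Xa j jX)).
(* [0] and [a] lie in different parts of the link, while [0] and [a * b] are two vertices of one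
   part. *)
apply: (@disconnected_link_depth _ _ _ F U o0 oa o0 oab).
- move=> i j; rewrite [i \in U]inE [j \in U]inE [j \in F]inE => /eqP i0 j0 _.
  rewrite lt0n j0 -leqNgt => aj.
  apply/negP=> /one_paired_face h.
  have [r0|r0] := eqVneq (j %% a) 0.
    have := h i j; rewrite !inE !eqxx orbT => /(_ isT isT).
    by rewrite -modab i0 mod0n r0 => /(_ erefl) e; rewrite -e in j0.
  (* Here [j] is already adjacent to the vertex [j %% a] of [F]. *)
  have ra : j %% a < a by rewrite ltn_mod.
  have rn : j %% a < n := ltn_trans ra an.
  have rF : Ordinal rn \in F.
    by rewrite inE /= (modn_small (ltn_trans ra a_ab)) lt0n r0.
  have := h j (Ordinal rn); rewrite !in_setU1 rF eqxx !orbT => /(_ isT isT) /=.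
  rewrite modn_mod (modn_small (ltn_trans ra a_ab)) => /(_ erefl) e.
  by rewrite e leqNgt ra in aj.
- by rewrite inE /= mod0n.
- by rewrite inE /= mod0n.
- apply: small => i; rewrite !inE => /orP[/eqP->|/andP[]//].
  by rewrite mod0n.
- by rewrite inE /= modn_small // -lt0n.
- by rewrite inE /= modn_small // ltnn andbF.
- apply/one_paired_face => i j; rewrite !inE.
  have key (l : nat) : 0 < l %% (a * b) < a -> l %% a <> 0.
    by move=> /andP[l0 la]; rewrite -modab modn_small // => l1; rewrite l1 in l0.
  move=> /orP[/eqP->|iF] /orP[/eqP->|jF] //=; rewrite ?modnn.
  + by move=> /esym/(key _ jF).
  + by move=> /(key _ iF).
  + move: iF jF => /andP[_ ia] /andP[_ ja].
    by rewrite -modab -(modab j) (modn_small ia) (modn_small ja).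
- by rewrite inE /= mod0n.
- by rewrite inE /= modnn.
- by rewrite -val_eqE /= eq_sym -lt0n.
- apply: small => i; rewrite !inE => /or3P[/eqP->|/eqP->|/andP[]//].
    by rewrite mod0n.
  by rewrite modnn.
Qed.

End OnePaired.

(** Vertices below [a * b] are determined by their residue modulo [a * b], so a face has at most one
    vertex in each class modulo [a], taken as its colour. *)
Lemma one_paired_cm (a b : nat) : 0 < a -> 1 < b ->
  cohen_macaulay_graph (one_paired (a * b) a b).
Proof.
move=> a_gt0 b_gt1 k.
pose chi (i : 'I_(a * b)) : 'I_a := Ordinal (ltn_pmod i a_gt0).
apply: (@partition_complex_cm k _ _ chi).
- move=> j; have jab : j < a * b.
    by apply: leq_trans (ltn_ord j) _; rewrite leq_pmulr // ltnW.
  by exists (Ordinal jab); apply: val_inj; rewrite /= modn_small.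
- move=> F; rewrite one_paired_face //; split=> h i j iF jF.
    move=> /(congr1 val) /= /(h i j iF jF).
    by rewrite !modn_small // => e; apply: val_inj.
  by move=> e; rewrite (h i j iF jF) //; apply: val_inj.
Qed.

Theorem theorem5p4 (k : fieldType) (n a b : nat)
    (n_gt0 : (0 < n)%N) (a_gt0 : (0 < a)%N) (b_gt1 : (1 < b)%N)
    (ab_dvd_n : (a * b %| n)%N) :
  (serre_graph k 2 (one_paired n a b) <-> n = (a * b)%N) /\
  (n = (a * b)%N <-> cohen_macaulay_graph (one_paired n a b)).
Proof.
have cm : n = a * b -> cohen_macaulay_graph (one_paired n a b).
  by move=> ->; apply: one_paired_cm.
(* Serves both converses: Cohen-Macaulayness supplies the hypothesis with [t = d]. *)
have eq_ab (K : fieldType) : (forall p, exists t d, 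
    [/\ @local_depth (@localization (sr_ring K (Ind (one_paired n a b))) p) t,
        krull_dim (localization p) d & minn 2 d <= t]) -> n = a * b.
  move=> h; apply/eqP; have := dvdn_leq n_gt0 ab_dvd_n.
  rewrite leq_eqVlt eq_sym => /orP[//|ab_lt_n].
  have [p pP] := one_paired_not_S2 a_gt0 b_gt1 ab_dvd_n ab_lt_n K.
  have [t [d [dt dd]]] := h p; have [t1 d2] := pP t d dt dd.
  by rewrite (minn_idPl d2) leqNgt ltnS t1.
split; split=> [|e].
- exact: eq_ab.
- move=> p; have [d [depth dim]] := cm e k p.
  by exists d, d; rewrite geq_minr.
- exact: cm.
- apply: (eq_ab k) => p; have [d [depth dim]] := e k p.
  by exists d, d; rewrite geq_minr.
Qed.
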